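(* Let $\mathcal{D}=(x_0,x_1)=(0,1)$, $T\in(0,\infty)$, $\theta\in\mathbf{R}$, $\lambda\in\mathbf{R}\setminus\{0\}$, $0<\sigma<2$. For $N\in\mathbf{N}$, $\tau=T/N$, $t_n=n\tau$, let $\{u^n\}_{0\le n\le N}$ be the solution of the mid-point scheme $$\mathrm{i}\frac{u^{n+1}-u^{n}}{\tau}+\Delta u^{n+\frac12}+\theta|x|^2u^{n+\frac12}+\lambda|u^{n+\frac12}|^{2\sigma}u^{n+\frac12}=\frac{W(t_{n+1})-W(t_n)}{\tau},\qquad 0\le n\le N-1,$$ with homogeneous Dirichlet boundary conditions, where $u^{n+\frac12}=\frac12(u^n+u^{n+1})$, and write $u^n=p^n+\mathrm{i}q^n$ with $p^n,q^n$ real-valued. Then the scheme possesses the discrete symplectic structure $$\overline{\omega}^{n}:=\int_{x_0}^{x_1}dp^{n}\wedge dq^{n}\,dx ,\qquad\text{i.e.}\qquad \overline{\omega}^{n+1}=\overline{\omega}^{n}\quad\text{for } 0\le n\le N-1 .$$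
   Context: $(\Omega,\mathcal{F},\mathbf{P})$ is a probability space with a normal filtration $\{\mathcal{F}_t\}_{t\ge0}$. $U$ is a Hilbert space with orthonormal basis $\{e_k\}_{k\in\mathbf{N}}$; $\beta_k=\beta_k^1+\mathrm{i}\beta_k^2$, where $\{\beta_k^i\}_{k\in\mathbf{N},\,i=1,2}$ is a family of independent identically distributed real Brownian motions; $W(t)=\sum_k\beta_k(t)\,\phi e_k$ with $\phi$ a Hilbert--Schmidt operator from $U$ into a Sobolev space $H^s(\mathcal{D})$. Here $d$ in $dp^n$, $dq^n$ is the exterior differential on the phase space, i.e. the differential of $p^n,q^n$ with respect to the initial data $(p^0,q^0)$ (the noise increments being fixed, so that they have zero differential); $\wedge$ is the wedge product taken pointwise in $x$, so that $\overline{\omega}^n$ is a two-form on phase space. The equality is understood almost surely. *)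

(* Defs.v *)
From HB Require Import structures.
From mathcomp Require Import all_boot all_order all_algebra.
From mathcomp Require Import all_classical all_reals all_analysis.
From mathcomp Require Import complex.

Set Implicit Arguments.
Unset Strict Implicit.
Unset Printing Implicit Defensive.

Import Order.TTheory GRing.Theory Num.Theory.
Import numFieldNormedType.Exports.

Local Open Scope classical_set_scope.
Local Open Scope ring_scope.
Local Open Scope complex_scope.

(* Functions on the spatial domain (0,1) are represented by total functions on
   R; no definition below depends on their values outside [0,1]. *)

Section Sobolev.
Context {R : realType}.
Implicit Types (f g : R -> R) (u : R -> R[i]) (s : R).

Definition dom : set R := `]0, 1[%classic.

Definition rep u : R -> R := fun x => complex.Re (u x).
Definition imp u : R -> R := fun x => complex.Im (u x).

Definition test_function f : Prop :=
  [/\ forall x, derivable f x 1,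
      continuous (derive1 f) &
      exists a b : R, [/\ 0 < a, b < 1 & forall x, ~~ (a <= x <= b) -> f x = 0]].

Definition is_weak_derivative f g : Prop :=
  [/\ locally_integrable dom f,
      locally_integrable dom g &
      forall psi, test_function psi ->
        \int[lebesgue_measure]_(x in dom) (f x * derive1 psi x) =
        - \int[lebesgue_measure]_(x in dom) (g x * psi x)].

(* The weak derivative, unique up to a null set; 0 if there is none. *)
Definition wderiv f : R -> R := xget (fun=> 0) [set g | is_weak_derivative f g].

Definition l2_sqnorm f : \bar R :=
  (\int[lebesgue_measure]_(x in dom) (f x ^+ 2)%:E)%E.

Definition slobodeckij_sqnorm (r : R) f : \bar R :=
  (\int[lebesgue_measure]_(x in dom) \int[lebesgue_measure]_(y in dom)
     ((f x - f y) ^+ 2 / `|x - y| `^ (1 + 2 * r))%:E)%E.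

(* Squared norm of H^s(0,1), s >= 0: that of W^{k,2} with k the integer part
   of s, plus the Gagliardo seminorm of order s - k of the k-th derivative
   when s is not an integer. *)
Definition sobolev_sqnorm s f : \bar R :=
  (\sum_(j < (Num.truncn s).+1) l2_sqnorm (iter j wderiv f) +
   if s == (Num.truncn s)%:R then 0
   else slobodeckij_sqnorm (s - (Num.truncn s)%:R)
          (iter (Num.truncn s) wderiv f))%E.

Definition in_sobolev s f : Prop :=
  [/\ measurable_fun dom f,
      forall j, (j < Num.truncn s)%N ->
        is_weak_derivative (iter j wderiv f) (iter j.+1 wderiv f) &
      (sobolev_sqnorm s f < +oo)%E].

Definition in_sobolevC s u : Prop := in_sobolev s (rep u) /\ in_sobolev s (imp u).
Definition sobolev_sqnormC s u : \bar R :=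
  (sobolev_sqnorm s (rep u) + sobolev_sqnorm s (imp u))%E.

(* Elements of H^1_0(0,1) are represented by functions continuous on [0,1], so
   that the homogeneous Dirichlet condition holds pointwise. *)
Definition in_H10 f : Prop :=
  [/\ in_sobolev 1 f, {within `[0, 1], continuous f} & f 0 = 0 /\ f 1 = 0].
Definition in_H10C u : Prop := in_H10 (rep u) /\ in_H10 (imp u).

Definition H1norm f : R := Num.sqrt (fine (sobolev_sqnorm 1 f)).
Definition H1normC u : R := Num.sqrt (fine (sobolev_sqnormC 1 u)).

Definition laplacian u : R -> R[i] :=
  fun x => wderiv (wderiv (rep u)) x +i* wderiv (wderiv (imp u)) x.

End Sobolev.

Section Noise.
Context {R : realType} {d : measure_display} {Omega : measurableType d}.
Variable P : probability Omega R.

Definition normal_filtration (F : R -> set (set Omega)) : Prop :=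
  [/\ forall t : R, 0 <= t -> sigma_algebra setT (F t) /\ F t `<=` measurable,
      forall r t : R, 0 <= r -> r <= t -> F r `<=` F t,
      forall A, measurable A -> P A = 0%E -> F 0 A &
      forall t : R, 0 <= t -> F t = \bigcap_(r in [set r | t < r]) F r].

Definition increment (B : R -> Omega -> R) (r t : R) : Omega -> R :=
  fun w => B t w - B r w.

Definition brownian_motion (F : R -> set (set Omega)) (B : R -> Omega -> R) : Prop :=
  [/\ {ae P, forall w, B 0 w = 0},
      {ae P, forall w, {within `[0, +oo[, continuous (fun t => B t w)}},
      forall t : R, 0 <= t -> forall A : set R, measurable A -> F t (B t @^-1` A),
      forall r t : R, 0 <= r -> r < t -> forall A : set R, measurable A ->
        P (increment B r t @^-1` A) = normal_prob 0 (Num.sqrt (t - r)) A &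
      forall r t : R, 0 <= r -> r < t -> forall (A : set R) (E : set Omega),
        measurable A -> F r E ->
        P (E `&` increment B r t @^-1` A) =
        (P E * P (increment B r t @^-1` A))%E].

Definition process_sigma_algebra (B : R -> Omega -> R) : set (set Omega) :=
  <<s [set E | exists t : R, exists2 A : set R,
         0 <= t /\ measurable A & E = B t @^-1` A] >>.

Definition mutually_independent (I : choiceType) (G : I -> set (set Omega)) : Prop :=
  forall (J : seq I) (E : I -> set Omega), uniq J ->
    (forall i, i \in J -> G i (E i)) ->
    P (\bigcap_(i in [set` J]) E i) = (\prod_(i <- J) P (E i))%E.

(* The real Brownian motion beta_k^1 is [beta k 0], and beta_k^2 is [beta k 1].
   They are identically distributed because each of them is a standard
   Brownian motion. *)
Definition iid_brownian_family (F : R -> set (set Omega))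
    (beta : nat -> 'I_2 -> R -> Omega -> R) : Prop :=
  (forall k i, brownian_motion F (beta k i)) /\
  mutually_independent
    (fun ki : nat * 'I_2 => process_sigma_algebra (beta ki.1 ki.2)).

Definition inner_product (U : completeNormedModType R) (ip : U -> U -> R) : Prop :=
  [/\ forall v w, ip v w = ip w v,
      forall (a : R) v v' w, ip (a *: v + v') w = a * ip v w + ip v' w &
      forall v, ip v v = `|v| ^+ 2].

Definition orthonormal_basis (U : completeNormedModType R) (ip : U -> U -> R)
    (e : nat -> U) : Prop :=
  (forall j k, ip (e j) (e k) = (j == k)%:R) /\
  (forall v, (fun n => \sum_(k < n) ip v (e k) *: e k) @ \oo --> v).

(* Hilbert-Schmidt operators from U into H^s((0,1); C).  The latter is regarded
   as a real Hilbert space, so that phi is only required to be R-linear. *)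
Definition hilbert_schmidt (U : completeNormedModType R) (e : nat -> U) (s : R)
    (phi : U -> R -> R[i]) : Prop :=
  [/\ forall v, in_sobolevC s (phi v),
      forall (a : R) v w, {ae lebesgue_measure, forall x, dom x ->
        phi (a *: v + w) x = a%:C * phi v x + phi w x},
      exists C : R, forall v, (sobolev_sqnormC s (phi v) <= (C * `|v| ^+ 2)%:E)%E &
      (\sum_(0 <= k <oo) sobolev_sqnormC s (phi (e k)) < +oo)%E].

(* W(t) = \sum_k beta_k(t) phi e_k, with beta_k = beta_k^1 + i beta_k^2: for
   each t the series converges almost surely in H^s. *)
Definition wiener_process (U : completeNormedModType R) (e : nat -> U) (s : R)
    (phi : U -> R -> R[i]) (beta : nat -> 'I_2 -> R -> Omega -> R)
    (W : R -> Omega -> R -> R[i]) : Prop :=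
  forall t : R, 0 <= t -> {ae P, forall w,
    in_sobolevC s (W t w) /\
    (fun n => sobolev_sqnormC s (fun x =>
       W t w x - \sum_(k < n) (beta k 0 t w +i* beta k 1 t w) * phi (e k) x))
      @ \oo --> 0%E}.

End Noise.

Section Scheme.
Context {R : realType}.
Implicit Types (tau theta lambda sigma : R) (N : nat) (dW v : nat -> R -> R[i]).

Definition midpoint v (n : nat) : R -> R[i] := fun x => (v n x + v n.+1 x) / 2.

(* [dW n] stands for W(t_{n+1}) - W(t_n).  The homogeneous Dirichlet conditions
   are carried by [in_H10C]; the midpoints lie in the domain of the Dirichlet
   Laplacian, i.e. they are moreover in H^2, and the equation is an identity
   between elements of L^2. *)
Definition midpoint_scheme tau theta lambda sigma N dW v : Prop :=
  (forall n, (n <= N)%N -> in_H10C (v n)) /\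
  (forall n, (n < N)%N ->
     in_sobolevC 2 (midpoint v n) /\
     {ae lebesgue_measure, forall x, dom x ->
        'i * ((v n.+1 x - v n x) / tau%:C)
        + laplacian (midpoint v n) x
        + (theta * `|x| ^+ 2)%:C * midpoint v n x
        + (lambda * Normc.normc (midpoint v n x) `^ (2 * sigma))%:C * midpoint v n x
        = dW n x / tau%:C}).

End Scheme.

Section PhaseSpace.
Context {R : realType}.

(* A point p^0 + i q^0 of the phase space H^1_0((0,1); C), regarded as a real
   normed space. *)
Local Notation phase := (R -> R[i]).

Definition phase_open (X0 : set phase) : Prop :=
  X0 `<=` [set v | in_H10C v] /\
  forall v, X0 v -> exists2 delta : R, 0 < delta &
    forall h, in_H10C h -> H1normC h < delta -> X0 (fun x => v x + h x).

(* Frechet differential at v of a map from (an open subset of) the phase space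
   to the real space H^1_0(0,1). *)
Definition is_differential (G : phase -> R -> R) (v : phase)
    (A : phase -> R -> R) : Prop :=
  [/\ forall h, in_H10C h -> in_H10 (A h),
      forall (a : R) h k, in_H10C h -> in_H10C k -> forall x, dom x ->
        A (fun y => a%:C * h y + k y) x = a * A h x + A k x,
      exists C : R, forall h, in_H10C h -> H1norm (A h) <= C * H1normC h &
      forall eps : R, 0 < eps -> exists2 delta : R, 0 < delta &
        forall h, in_H10C h -> H1normC h < delta ->
          H1norm (fun x => G (fun y => v y + h y) x - G v x - A h x)
            <= eps * H1normC h].

Definition phase_differentiable (G : phase -> R -> R) (v : phase) : Prop :=
  exists A, is_differential G v A.

Definition differential (G : phase -> R -> R) (v : phase) : phase -> R -> R :=
  xget (fun=> fun=> 0) [set A | is_differential G v A].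

Definition wedge (alpha beta : phase -> R) : phase -> phase -> R :=
  fun h k => alpha h * beta k - alpha k * beta h.

(* Real and imaginary parts p^n, q^n of a map u^n defined on the phase space. *)
Definition p_part (un : phase -> R -> R[i]) : phase -> R -> R := fun v => rep (un v).
Definition q_part (un : phase -> R -> R[i]) : phase -> R -> R := fun v => imp (un v).

(* The two-form \int_0^1 dp^n /\ dq^n dx at the point v, evaluated on the
   tangent vectors h and k. *)
Definition symplectic_form (un : phase -> R -> R[i]) (v h k : phase) : R :=
  \int[lebesgue_measure]_(x in dom)
    wedge (fun h' => differential (p_part un) v h' x)
          (fun h' => differential (q_part un) v h' x) h k.

(* [u n v] is the n-th iterate u^n started from u^0 = v, for v in the open set X0
   of initial data; it is differentiable with respect to v, the noise
   increments being fixed. *)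
Definition solution_map (tau theta lambda sigma : R) (N : nat)
    (dW : nat -> R -> R[i]) (X0 : set phase) (u : nat -> phase -> R -> R[i]) : Prop :=
  [/\ phase_open X0,
      forall v, X0 v -> forall x, dom x -> u 0%N v x = v x,
      forall v, X0 v ->
        midpoint_scheme tau theta lambda sigma N dW (fun n => u n v) &
      forall n, (n <= N)%N -> forall v, X0 v ->
        phase_differentiable (p_part (u n)) v /\
        phase_differentiable (q_part (u n)) v].

End PhaseSpace.

(* Main.v *)
Require Import Defs.
From HB Require Import structures.
From mathcomp Require Import all_boot all_order all_algebra.
From mathcomp Require Import all_classical all_reals all_analysis.
From mathcomp Require Import measurable_realfun complex ring lra.

Set Implicit Arguments.
Unset Strict Implicit.
Unset Printing Implicit Defensive.

Import Order.TTheory GRing.Theory Num.Theory.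
Import numFieldNormedType.Exports.

Local Open Scope classical_set_scope.
Local Open Scope ring_scope.
Local Open Scope complex_scope.

(** The noise is fixed along the differentiation, so the statement is pathwise.
    Write z = (P, Q) for the midpoint.  For two tangent vectors h, k replace
    d/dh and d/dk by difference quotients along v + e h and v + e k.  Subtracting
    the scheme at v removes the noise, and the increment over one step of
    dp /\ dq (h, k) becomes tau times the sum of
    - a Laplacian part, whose integral vanishes because Green's formula makes the
      Dirichlet Laplacian symmetric on H^2 and H^1_0 (the equation only holds
      in L^2, so the Laplacian cannot be differentiated, but it can be
      differenced);
    - a nonlinear part <d_h z, d_k F> - <d_k z, d_h F> with F = lambda |z|^(2 sigma) z.
      It tends to 0 pointwise as e -> 0, because the derivative of F is symmetric,
      and it is bounded, because differentiability in H^1_0 gives uniform bounds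
      for the quotients.
    Dominated convergence then yields the equality of the two-forms.  Weak
    derivatives are handled by the du Bois-Reymond lemma: an H^1_0 function is the
    primitive of its weak derivative. *)

(** * Test functions approximating the indicator of an interval *)

Section Bump.
Context {R : realType}.
Notation mu := (@lebesgue_measure R).

(** The derivative of F is symmetric because F is the gradient of lambda / (2 sigma + 2) |z|^(2
    sigma + 2). Two lacks of regularity shape the argument. The midpoints lie in H^2, but their
    dependence on the initial datum is controlled only in H^1_0; hence the Laplacian part has to
    vanish exactly for each fixed e. It does, since the wedge of difference quotients is a
    combination of the pairings z L z' - z' L z of the midpoints at v, v + e h and v + e k. What
    remains for the limit is uniform convergence, which H^1_0 convergence implies in one dimension.
    Moreover, for 2 sigma <= 1 the factor |z|^(2 sigma) is not differentiable at 0; the nonlinear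
    part is therefore rearranged so that each difference quotient of this factor carries a scalar
    product with z, which compensates the singularity. The mid-point rule enters through a
    reflection: u^n and u^(n+1) are z - delta and z + delta, so the increment of the two-form is
    twice its cross terms. The term theta |x|^2 z is a real multiple of z and cancels
    algebraically. *)

Lemma max0_le0 (y : R) : y <= 0 -> Num.max 0 y = 0.
Proof. by rewrite /Num.max /Order.max leNgt; case: ifP. Qed.

Lemma max0_ge0 (y : R) : 0 <= y -> Num.max 0 y = y.
Proof. by rewrite /Num.max /Order.max; case: ltgtP. Qed.

(** Squaring removes the kink of the positive part: at 0 the difference quotient is at most [|h|] in
    absolute value. *)
Lemma is_derive_sqr_pos_part (y : R) :
  is_derive y 1 (fun z : R => Num.max 0 z ^+ 2) (2 * Num.max 0 y).
Proof.
have [y0|y0|->] := ltgtP y 0.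
- apply: (@near_eq_is_derive _ _ _ (cst 0)).
    have E (z : R) : z < 0 -> Num.max 0 z ^+ 2 = 0.
      by move=> /ltW z0; rewrite max0_le0 ?expr0n.
    by near=> z; rewrite E//; near: z; exact: lt_nbhsl.
  by rewrite mulr0; exact: is_derive_cst.
- apply: (@near_eq_is_derive _ _ _ (fun z : R => z ^+ 2)).
    have E (z : R) : 0 < z -> Num.max 0 z ^+ 2 = z ^+ 2.
      by move=> /ltW z0; rewrite max0_ge0.
    by near=> z; rewrite E//; near: z; exact: lt_nbhsr.
  by apply: is_derive_eq; rewrite /GRing.scale/=; ring.
- rewrite mulr0.
  have H : (h : R)^-1 *: (Num.max 0 (h * 1 + 0) ^+ 2 - Num.max 0 0 ^+ 2 : R)
              @[h --> (0:R)^'] --> (0:R).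
    apply/cvgr0Pnorm_le => e e0; near=> h.
    have h0 : h != 0 by near: h; exact: nbhs_dnbhs_neq.
    have he : `|h| <= e by near: h; apply: dnbhs0_le.
    rewrite maxxx expr0n subr0 addr0 mulr1 /GRing.scale/= normrM normrX normfV.
    rewrite (le_trans _ he)// ler_pdivrMl ?normr_gt0// -expr2.
    rewrite lerXn2r ?nnegrE//.
    by rewrite /Num.max/Order.max; case: ifP => //; rewrite normr0.
  split; first by apply/cvg_ex; exists 0.
  by apply/cvg_lim.
Unshelve. all: by end_near. Qed.

Implicit Types a b c x : R.

(* This is [c beta / (1 + c beta)] with [beta x = max(0, (x - a)(b - x))^2]: it is
   C^1, supported in [a, b], and tends to the indicator of ]a, b[ as [c] grows. *)
Definition bump a b c x : R :=
  1 - (1 + c * Num.max 0 ((x - a) * (b - x)) ^+ 2)^-1.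

Lemma bump_denom_gt0 a b c x : 0 <= c ->
  0 < 1 + c * Num.max 0 ((x - a) * (b - x)) ^+ 2 :> R.
Proof. by move=> c0; rewrite ltr_wpDr// mulr_ge0// sqr_ge0. Qed.

Lemma is_derive_bump a b c x : 0 <= c ->
  is_derive x 1 (bump a b c)
    ((1 + c * Num.max 0 ((x - a) * (b - x)) ^+ 2) ^- 2 *
     (c * (2 * Num.max 0 ((x - a) * (b - x)) * (a + b - 2 * x)))).
Proof.
move=> c0; pose q x := (x - a) * (b - x).
have dq : is_derive x 1 q (a + b - 2 * x).
  by apply: is_derive_eq; rewrite /GRing.scale/=; ring.
have dp : is_derive x 1 (fun x => Num.max 0 (q x) ^+ 2)
    (2 * Num.max 0 (q x) * (a + b - 2 * x)).
  exact: (is_derive1_comp (is_derive_sqr_pos_part (q x)) dq).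
pose D x := 1 + c * Num.max 0 (q x) ^+ 2.
have d1 : is_derive x 1 D
    (c * (2 * Num.max 0 (q x) * (a + b - 2 * x))).
  by apply: is_derive_eq; rewrite /GRing.scale/=; ring.
have n0 : D x != 0.
  by rewrite gt_eqF// bump_denom_gt0.
have dV := is_deriveV n0 d1.
apply: is_derive_eq.
by rewrite /GRing.scale/= add0r mul1r mulNr opprK.
Qed.

Lemma continuous_max0 (f : R -> R) x : {for x, continuous f} ->
  {for x, continuous (fun y => Num.max 0 (f y))}.
Proof.
move=> cf; rewrite (_ : (fun y => _) = fun y => (f y + `|f y|) / 2).
  apply: cvgMl; apply: cvgD => //; exact: cvg_norm.
apply/funext => y; have [y0|y0] := leP (f y) 0.
  by rewrite ler0_norm// subrr mul0r.
by rewrite gtr0_norm//; field.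
Qed.

Lemma continuous_sqr (f : R -> R) x : {for x, continuous f} ->
  {for x, continuous (fun y => f y ^+ 2)}.
Proof.
move=> cf; rewrite (_ : (fun y => _) = fun y => f y * f y); first exact: cvgM.
by apply/funext => y; rewrite expr2.
Qed.

Lemma bump_test_function a b c : 0 < a -> b < 1 -> a <= b -> 0 <= c ->
  test_function (bump a b c).
Proof.
move=> a0 b1 ab c0; split.
- by move=> x; have [] := @is_derive_bump a b c x c0.
- rewrite (_ : derive1 _ = fun x =>
    (1 + c * Num.max 0 ((x - a) * (b - x)) ^+ 2) ^- 2 *
     (c * (2 * Num.max 0 ((x - a) * (b - x)) * (a + b - 2 * x)))).
    move=> x.
    have cq : {for x, continuous (fun x : R => (x - a) * (b - x))}.
      apply: cvgM; first by apply: cvgB; [exact: cvg_id|exact: cvg_cst].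
      by apply: cvgB; [exact: cvg_cst|exact: cvg_id].
    have cm := continuous_max0 cq.
    have n0 := @lt0r_neq0 _ _ (@bump_denom_gt0 a b c x c0).
    apply: cvgM; last first.
      apply: cvgMr; apply: cvgM; first by apply: cvgMr; exact: cm.
      by apply: cvgB; [exact: cvg_cst|apply: cvgMr; exact: cvg_id].
    apply: cvgV; first by rewrite expf_neq0.
    have cD : {for x, continuous
        (fun x => 1 + c * Num.max 0 ((x - a) * (b - x)) ^+ 2)}.
      by apply: cvgD; [exact: cvg_cst|apply: cvgMr; exact: (continuous_sqr cm)].
    exact: (continuous_sqr cD).
  apply/funext => x; rewrite derive1E.
  by have /@derive_val := @is_derive_bump a b c x c0.
- exists a, b; split => // x xab.
  rewrite /bump max0_le0 ?expr0n ?mulr0 ?addr0 ?invr1 ?subrr//.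
  move: xab; rewrite negb_and -!ltNge => /orP[xa|bx]; first by nra.
  by nra.
Qed.

Lemma bump_outside a b c x : ~~ (a < x < b) -> a <= b -> bump a b c x = 0.
Proof.
move=> xab ab.
rewrite /bump max0_le0 ?expr0n ?mulr0 ?addr0 ?invr1 ?subrr//.
by move: xab; rewrite negb_and -!leNgt => /orP[xa|bx]; nra.
Qed.

Lemma bump_ge0_le1 a b c x : 0 <= c -> 0 <= bump a b c x <= 1.
Proof.
move=> c0; have := @bump_denom_gt0 a b c x c0.
rewrite /bump; set d := 1 + _ => d0; have d1 : 1 <= d.
  by rewrite lerDl mulr_ge0// sqr_ge0.
by rewrite subr_ge0 invf_le1// d1/= gerBl invr_ge0 ltW.
Qed.

(** Inside the interval the distance to 1 is 1 / (1 + n q^2) with q = (x - a)(b - x) > 0, hence at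
    most 1 / (n q^2); outside, every bump is 0. *)
Lemma bump_cvg a b x : a <= b ->
  (fun n : nat => bump a b n%:R x) @ \oo --> (\1_`]a, b[ x : R).
Proof.
move=> ab; rewrite indicE; have [|] := boolP (x \in `]a, b[%classic); last first.
  rewrite notin_setE/= in_itv/= => /negP xab.
  rewrite (_ : (fun n : nat => _) = cst 0); first exact: cvg_cst.
  by apply/funext => n; rewrite bump_outside.
rewrite inE/= in_itv/= => /andP[ax xb]; rewrite -[X in _ --> X]subr0.
apply: cvgB; first exact: cvg_cst.
have q0 : 0 < ((x - a) * (b - x)) ^+ 2 by rewrite exprn_gt0// mulr_gt0// subr_gt0.
apply: (@squeeze_cvgr _ _ _ _ (cst 0)
  (fun n => (((x - a) * (b - x)) ^+ 2)^-1 * (n%:R)^-1)).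
- near=> n; have n0 : (0 < n)%N by near: n; exact: nbhs_infty_gt.
  rewrite max0_ge0; last by rewrite mulr_ge0// subr_ge0 ltW.
  set d := _ ^+ 2 in q0 *; have h : 0 < n%:R * d by rewrite mulr_gt0// ltr0n.
  rewrite /cst invr_ge0 addr_ge0 ?(ltW h)//= -invfM lef_pV2 ?posrE//.
  + by rewrite mulrC lerDr.
  + by rewrite addr_gt0.
  + by rewrite mulrC.
- exact: cvg_cst.
- rewrite -[X in _ --> X](mulr0 (((x - a) * (b - x)) ^+ 2)^-1).
  apply: cvgMr; apply/gtr0_cvgV0.
    by near=> n; rewrite ltr0n; near: n; exact: nbhs_infty_gt.
  exact: cvgr_idn.
Unshelve. all: by end_near. Qed.
End Bump.

(** * Real-valued integrals: dominated convergence and change of domain *)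

Lemma Rintegral_dominated_cvg d (T : measurableType d) (R : realType)
    (mu : {measure set T -> \bar R}) (D : set T) (f_ : nat -> T -> R) (f g : T -> R) :
  measurable D ->
  (forall n, measurable_fun D (f_ n)) ->
  (forall x, D x -> f_ ^~ x @ \oo --> f x) ->
  mu.-integrable D (EFin \o g) ->
  (forall n x, D x -> `|f_ n x| <= g x) ->
  (fun n => \int[mu]_(x in D) f_ n x) @ \oo --> \int[mu]_(x in D) f x.
Proof.
move=> mD mf ff ig fg.
have mf' := measurable_fun_cvg mf ff.
have h1 n : measurable_fun D (EFin \o f_ n) by exact/measurable_EFinP.
have h2 : measurable_fun D (EFin \o f) by exact/measurable_EFinP.
have h3 : {ae mu, forall x, D x -> (fun n => EFin \o f_ n) ^~ x @ \oo --> (EFin \o f) x}.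
  by apply: aeW => x Dx; apply/cvg_EFin; [exact: nearW|exact: ff].
have h4 : {ae mu, forall x n, D x -> (`|(EFin \o f_ n) x| <= (EFin \o g) x)%E}.
  by apply: aeW => x n Dx; rewrite /= lee_fin fg.
have [ifi _ H] := dominated_convergence mD h1 h2 h3 ig h4.
have h : (\int[mu]_(x in D) (EFin \o f) x = (\int[mu]_(x in D) f x)%:E)%E.
  by rewrite /Rintegral fineK//; exact: integrable_fin_num.
by rewrite h in H; exact: (fine_cvg H).
Qed.

Lemma Rintegral_subset_eq0 d (T : measurableType d) (R : realType)
    (mu : {measure set T -> \bar R}) (A D : set T) (f : T -> R) :
  A `<=` D -> (forall x, D x -> ~ A x -> f x = 0) ->
  \int[mu]_(x in D) f x = \int[mu]_(x in A) f x.
Proof.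
move=> AD f0; rewrite Rintegral_mkcond [RHS]Rintegral_mkcond.
apply: eq_Rintegral => x _; rewrite !patchE.
case: ifPn => [/set_mem Dx|/negP xD]; case: ifPn => [/set_mem Ax|/negP xA] //.
  by apply: f0 => // Ax; apply: xA; rewrite inE.
by exfalso; apply: xD; rewrite inE; exact: AD.
Qed.

(** * The fundamental lemma of the calculus of variations on (0,1) *)

Section Zero.
Context {R : realType}.
Notation mu := (@lebesgue_measure R).

Lemma ae_impl (P Q : R -> Prop) : (forall x, P x -> Q x) ->
  {ae mu, forall x, P x} -> {ae mu, forall x, Q x}.
Proof.
by move=> PQ; apply: filterS => //; exact: (ae_filter_ringOfSetsType mu).
Qed.

Lemma ae_impl2 (P Q S : R -> Prop) : (forall x, P x -> Q x -> S x) ->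
  {ae mu, forall x, P x} -> {ae mu, forall x, Q x} -> {ae mu, forall x, S x}.
Proof.
by move=> PQ; apply: filterS2 => //; exact: (ae_filter_ringOfSetsType mu).
Qed.

Lemma segment_sub_dom (a b : R) : 0 < a -> b < 1 -> `[a, b]%classic `<=` dom.
Proof.
move=> a0 b1 x; rewrite /dom /= !in_itv/= => /andP[ax xb].
by rewrite (lt_le_trans a0)// (le_lt_trans xb).
Qed.

Lemma locally_integrable_integrable (D : R -> R) (a b : R) :
  locally_integrable dom D -> 0 < a -> b < 1 ->
  mu.-integrable `[a, b] (EFin \o D).
Proof.
move=> [mD oD foo] a0 b1; have sab := segment_sub_dom a0 b1.
apply/integrableP; split.
  by apply/measurable_EFinP; apply: measurable_funS mD => //; exact: measurable_itv.
exact: (foo _ sab (@segment_compact _ a b)).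
Qed.

Lemma test_function_measurable (psi : R -> R) :
  test_function psi -> measurable_fun [set: R] psi.
Proof.
move=> [dpsi _ _]; apply: continuous_measurable_fun => x.
by apply: differentiable_continuous; apply/derivable1_diffP.
Qed.

(** Testing [D] against [bump a b n] and letting n grow, with [|D|] as dominating function on the
    compact interval, replaces the test function by the indicator of []a, b[]; the endpoints are
    null. *)
Lemma Rintegral_itv_eq0 (D : R -> R) : locally_integrable dom D ->
  (forall psi, test_function psi -> \int[mu]_(x in dom) (D x * psi x) = 0) ->
  forall a b, 0 < a -> b < 1 -> \int[mu]_(x in `[a, b]) D x = 0.
Proof.
move=> lD D0 a b a0 b1; have [ab|ba] := leP a b; last first.
  by rewrite set_itv_ge ?Rintegral_set0// bnd_simp -ltNge.
have iD := locally_integrable_integrable lD a0 b1.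
have sab := segment_sub_dom a0 b1.
have [mD oD _] := lD.
have mDab : measurable_fun `[a, b] D.
  by apply: measurable_funS mD => //; exact: measurable_itv.
have H : (fun n => \int[mu]_(x in `[a, b]) (D x * bump a b n%:R x)) @ \oo -->
    \int[mu]_(x in `[a, b]) (D x * \1_`]a, b[ x).
  apply: (@Rintegral_dominated_cvg _ _ _ mu _ _ _ (fun x => `|D x|)).
  - exact: measurable_itv.
  - move=> n; apply: measurable_funM => //.
    apply: measurable_funTS; apply: test_function_measurable.
    exact: bump_test_function.
  - by move=> x _; apply: cvgMr; exact: bump_cvg.
  - exact: (integrable_norm iD).
  - move=> n x _; rewrite normrM ler_piMr//.
    have /andP[p0 p1] := @bump_ge0_le1 R a b n%:R x (ler0n _ _).
    by rewrite ger0_norm.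
have E : (fun n => \int[mu]_(x in `[a, b]) (D x * bump a b n%:R x)) = cst 0.
  apply/funext => n; rewrite -(@D0 (bump a b n%:R)).
    apply/esym/Rintegral_subset_eq0 => // x _ /= /negP xab.
    rewrite bump_outside ?mulr0//; apply: contra xab.
    by rewrite in_itv/= => /andP[/ltW-> /ltW->].
  exact: bump_test_function.
rewrite E in H.
have {H} := cvg_unique (@Rhausdorff R) H (@cvg_cst _ (0:R) _ \oo _).
rewrite (@Rintegral_subset_eq0 _ _ _ mu `]a, b[); last 2 first.
- by apply: subset_itv; rewrite bnd_simp.
- by move=> x _ xab; rewrite indicE memNset// mulr0.
rewrite (_ : \int[mu]_(x in _) _ = \int[mu]_(x in `]a, b[) D x).
  move=> <-.
  rewrite -Rintegral_itv_obnd_cbnd; last first.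
    by apply: integrableS iD => //; apply: subset_itv; rewrite bnd_simp.
  rewrite -Rintegral_itv_bndo_bndc//.
  by apply: integrableS iD => //; apply: subset_itv; rewrite bnd_simp.
by apply: eq_Rintegral => x xab; rewrite indicE xab mulr1.
Qed.

(** On each compact interval of an exhaustion of (0,1), the restriction of [D] extended by 0 is
    integrable and its indefinite integral is identically 0; Lebesgue differentiation then gives [D]
    = 0 almost everywhere there, and countably many null sets are collected. *)
Lemma locally_integrable_ae0 (D : R -> R) : locally_integrable dom D ->
  (forall psi, test_function psi -> \int[mu]_(x in dom) (D x * psi x) = 0) ->
  {ae mu, forall x, dom x -> D x = 0}.
Proof.
move=> lD D0.
have H n : {ae mu, forall x, x \in `[n.+2%:R^-1, 1 - n.+2%:R^-1] -> D x = 0}.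
  set a := n.+2%:R^-1 : R; have a0 : 0 < a by rewrite invr_gt0.
  have b1 : 1 - a < 1 by rewrite ltrBlDr ltrDl.
  pose I := `[a, 1 - a]%classic.
  have iD := locally_integrable_integrable lD a0 b1.
  have iT : mu.-integrable setT (EFin \o (D \_ I)).
    rewrite -restrict_EFin /I; apply/integrable_restrict => //=.
    by rewrite setTI; exact: iD.
  (* Only the part of []-oo, y]] inside [I] counts, that is [[a, min(y, 1 - a)]], which is empty
     when y < a. *)
  have F0 y : \int[mu]_(t in `]-oo, y]) (D \_ I) t = 0.
    rewrite (@Rintegral_subset_eq0 _ _ _ mu `[a, Num.min y (1 - a)]).
    - transitivity (\int[mu]_(t in `[a, Num.min y (1 - a)]) D t); last first.
        by apply: (Rintegral_itv_eq0 lD D0) => //; rewrite gt_min b1 orbT.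
      apply: eq_Rintegral => x; rewrite inE/= in_itv/= le_min => /and3P[ax xy xa].
      by rewrite patchE mem_set// /I/= in_itv/= ax.
    - by move=> x; rewrite /= !in_itv/= le_min => /and3P[].
    - move=> x; rewrite /= !in_itv/= le_min => xy /negP.
      rewrite patchE; case: ifPn => //; rewrite inE /I/= in_itv/=.
      by move=> /andP[-> ->]; rewrite xy.
  have lT : locally_integrable setT (D \_ I).
    by apply: integrable_locally_restrict => //; exact: measurable_itv.
  have iy y : mu.-integrable `]-oo, y] (EFin \o (D \_ I)).
    by apply: integrableS iT => //; exact: measurable_itv.
  have := FTC1Ny iy lT.
  apply: ae_impl => x []; rewrite (_ : (fun x => _) = cst 0); last first.
    by apply/funext => z; rewrite F0.
  rewrite derive1E derive_cst => _ + xI.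
  by rewrite patchE mem_set.
have /ae_foralln := H.
apply: ae_impl => x h; rewrite /dom/= in_itv/= => /andP[x0 x1].
have e0 : 0 < Num.min x (1 - x) by rewrite lt_min x0 subr_gt0.
have [N _ /(_ N)/(_ (leqnn _)) HN] := near_infty_natSinv_lt (PosNum e0).
apply: (h N); rewrite in_itv/=.
have : N.+2%:R^-1 < Num.min x (1 - x).
  by apply: lt_trans HN; rewrite ltf_pV2 ?posrE// ltr_nat.
by rewrite lt_min => /andP[/ltW-> h2]; rewrite lerBrDl -lerBrDr ltW.
Qed.

End Zero.

(** * Fubini on a triangle *)

Section Primitive.
Context {R : realType}.
Notation mu := (@lebesgue_measure R).
Implicit Types (f g h : R -> R).

Definition primitive g (x : R) : R := \int[mu]_(t in `[0, x]) g t.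

Lemma integrable_scale (D : set R) (c : R) f : measurable D ->
  mu.-integrable D (EFin \o f) -> mu.-integrable D (EFin \o (fun x => c * f x)).
Proof.
move=> mD fi; rewrite (_ : EFin \o _ = fun x => (c%:E * (EFin \o f) x)%E)//.
exact: integrableZl.
Qed.

Lemma integrable_restrictT f (a b : R) : mu.-integrable `[a, b] (EFin \o f) ->
  mu.-integrable setT (EFin \o (f \_ `[a, b])).
Proof.
move=> fi; rewrite -restrict_EFin; apply/integrable_restrict => //=.
by rewrite setTI.
Qed.

(** The product g1(x) g2(y) restricted to the triangle 0 <= y <= x <= 1. *)
Let tri g1 g2 (z : R * R) : R :=
  if z.2 <= z.1 then (g1 \_ `[0, 1]) z.1 * (g2 \_ `[0, 1]) z.2 else 0.

(** Both sides are iterated integrals of [tri g1 g2], in the two orders. This serves as integration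
    by parts for functions known only as primitives of integrable functions. *)
Lemma Fubini_triangle g1 g2 :
  mu.-integrable `[0, 1] (EFin \o g1) -> mu.-integrable `[0, 1] (EFin \o g2) ->
  \int[mu]_(x in `[0, 1]) (g1 x * primitive g2 x) =
  \int[mu]_(y in `[0, 1]) ((primitive g1 1 - primitive g1 y) * g2 y).
Proof.
move=> i1 i2; set h1 := g1 \_ `[0, 1]; set h2 := g2 \_ `[0, 1].
have j1 : mu.-integrable setT (EFin \o h1) by exact: integrable_restrictT.
have j2 : mu.-integrable setT (EFin \o h2) by exact: integrable_restrictT.
have m1 : measurable_fun setT h1 by apply/measurable_EFinP; case/integrableP: j1.
have m2 : measurable_fun setT h2 by apply/measurable_EFinP; case/integrableP: j2.
have mt : measurable_fun setT (EFin \o tri g1 g2).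
  apply/measurable_EFinP; apply: measurable_fun_ifT => //.
  - by apply: measurable_fun_ler; [exact: measurable_snd|exact: measurable_fst].
  - by apply: measurable_funM; apply: measurableT_comp.
have jx x : mu.-integrable setT (EFin \o (fun y => tri g1 g2 (x, y))).
  apply: (le_integrable measurableT _ _ (integrable_scale (h1 x) measurableT j2)).
    exact: (measurableT_comp mt (pair1_measurable x)).
  by move=> y _; rewrite lee_fin /tri /=; case: ifP => //= _; rewrite normr0.
have jy y : mu.-integrable setT (EFin \o (fun x => tri g1 g2 (x, y))).
  apply: (le_integrable measurableT _ _ (integrable_scale (h2 y) measurableT j1)).
    exact: (measurableT_comp mt (pair2_measurable y)).
  move=> x _; rewrite lee_fin /tri /= [h2 y * _]mulrC.
  by case: ifP => //= _; rewrite normr0.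
have Ex x : \int[mu]_y tri g1 g2 (x, y) = h1 x * primitive g2 x.
  have [x01|x01] := boolP (x \in `[0, 1]%classic); last first.
    rewrite [h1 x]patchE (negbTE x01) mul0r.
    rewrite (@eq_Rintegral _ _ _ _ _ (cst 0)) ?Rintegral_cst// ?mul0r// => y _.
    by rewrite /tri/= [X in X * _]patchE (negbTE x01) mul0r; case: ifP.
  rewrite /primitive -RintegralZl//; last first.
    apply: integrableS i2 => //; apply: subset_itvl.
    by move: x01; rewrite inE/= in_itv/= bnd_simp => /andP[].
  rewrite (@Rintegral_subset_eq0 _ _ _ mu `[0, x])//.
    apply: eq_Rintegral => y; rewrite inE/= in_itv/= => /andP[y0 yx].
    rewrite /tri/= yx [in X in _ * X]patchE mem_set//=.
    move: x01; rewrite inE/= !in_itv/= y0 => /andP[_].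
    exact: le_trans.
  move=> y _; rewrite /tri/= in_itv/= => /negP; rewrite negb_and.
  case: ifP => //= yx; rewrite orbF => y0.
  rewrite [in X in _ * X]patchE memNset ?mulr0//= in_itv/= => /andP[].
  by rewrite (negbTE y0).
have Ey y : \int[mu]_x tri g1 g2 (x, y) = (primitive g1 1 - primitive g1 y) * h2 y.
  have [y01|y01] := boolP (y \in `[0, 1]%classic); last first.
    rewrite [h2 y]patchE (negbTE y01) mulr0.
    rewrite (@eq_Rintegral _ _ _ _ _ (cst 0)) ?Rintegral_cst// ?mul0r// => x _.
    by rewrite /tri/= [X in _ * X]patchE (negbTE y01) mulr0; case: ifP.
  have := y01; rewrite inE/= in_itv/= => /andP[y0 y1].
  have iy : mu.-integrable `]y, 1] (EFin \o g1).
    by apply: integrableS i1 => //; apply: subset_itvr; rewrite bnd_simp.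
  rewrite /primitive Rintegral_itvB ?bnd_simp//.
  rewrite -RintegralZr// Rintegral_itv_obnd_cbnd; last first.
    have := integrable_scale (h2 y) (measurable_itv _) iy.
    by apply: eq_integrable => // x _; rewrite /= mulrC.
  rewrite [LHS](@Rintegral_subset_eq0 _ _ _ mu `[y, 1])//.
    apply: eq_Rintegral => x; rewrite inE/= in_itv/= => /andP[yx x1].
    rewrite /tri/= yx [in X in X * _]patchE mem_set//= in_itv/= x1 andbT.
    exact: le_trans yx.
  move=> x _; rewrite /tri/= in_itv/= => /negP; rewrite negb_and.
  case: ifP => //= yx x1.
  rewrite [in X in X * _]patchE memNset ?mul0r//= in_itv/= => /andP[_].
  by rewrite (negbTE x1).
(* By Tonelli: the inner integral of the absolute value is at most [|h1 x|] times the L^1 norm of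
   [h2], which is integrable in x. *)
have imt : (mu \x mu)%E.-integrable setT (EFin \o tri g1 g2).
  apply/integrable12ltyP => //.
  have n1 : (\int[mu]_x `|(h1 x)%:E| < +oo)%E by case/integrableP: j1.
  have n2 : (\int[mu]_x `|(h2 x)%:E| < +oo)%E by case/integrableP: j2.
  have mF : measurable_fun setT (fun x => (\int[mu]_y `|(EFin \o tri g1 g2) (x, y)|)%E).
    apply: (@measurable_fun_fubini_tonelli_F _ _ _ _ _ mu
      (fun z => `|(EFin \o tri g1 g2) z|%E)) => //.
    exact: measurableT_comp mt.
  have mG : measurable_fun setT (fun x => (`|(h1 x)%:E| * \int[mu]_y `|(h2 y)%:E|)%E).
    by apply: emeasurable_funM => //; apply: measurableT_comp => //; exact/measurable_EFinP.
  apply: (@le_lt_trans _ _ (\int[mu]_x (`|(h1 x)%:E| * \int[mu]_y `|(h2 y)%:E|))%E).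
    apply: ge0_le_integral => //.
      by move=> x _; exact: integral_ge0.
    move=> x _; rewrite -ge0_integralZl//; last first.
        by apply: measurableT_comp => //; exact/measurable_EFinP.
      apply: ge0_le_integral => //.
      + by apply: measurableT_comp => //; case/integrableP: (jx x).
      + by apply: emeasurable_funM => //; apply: measurableT_comp => //; exact/measurable_EFinP.
      + move=> y _; rewrite /= -EFinM lee_fin -normrM /tri/=.
        by case: ifP => //; rewrite normr0.
  rewrite ge0_integralZr//; last exact: integral_ge0; last first.
    by apply: measurableT_comp => //; exact/measurable_EFinP.
  by rewrite lte_mul_pinfty ?integral_ge0// ge0_fin_numE// integral_ge0.
have FX : (\int[mu]_x \int[mu]_y (EFin \o tri g1 g2) (x, y) =
    \int[mu]_x (h1 x * primitive g2 x)%:E)%E.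
  apply: eq_integral => x _; rewrite -Ex /Rintegral fineK//.
  exact: (integrable_fin_num measurableT (jx x)).
have FY : (\int[mu]_y \int[mu]_x (EFin \o tri g1 g2) (x, y) =
    \int[mu]_y ((primitive g1 1 - primitive g1 y) * h2 y)%:E)%E.
  apply: eq_integral => y _; rewrite -Ey /Rintegral fineK//.
  exact: (integrable_fin_num measurableT (jy y)).
have E : \int[mu]_x (h1 x * primitive g2 x) =
    \int[mu]_y ((primitive g1 1 - primitive g1 y) * h2 y).
  by congr fine; rewrite -FX -FY; exact: Fubini imt.
move: E.
rewrite (@Rintegral_subset_eq0 _ _ _ mu `[0, 1])//; last first.
  by move=> x _ x01; rewrite /h1 patchE memNset ?mul0r.
rewrite [RHS](@Rintegral_subset_eq0 _ _ _ mu `[0, 1])//; last first.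
  by move=> x _ x01; rewrite /h2 patchE memNset ?mulr0.
move=> E; transitivity (\int[mu]_(x in `[0, 1]) (h1 x * primitive g2 x)).
  by apply: eq_Rintegral => x x01; rewrite /h1 patchE x01.
by rewrite E; apply: eq_Rintegral => x x01; rewrite /h2 patchE x01.
Qed.
End Primitive.

(** * Weak derivatives and primitives *)

Lemma integrable_subset_eq0 d (T : measurableType d) (R : realType)
    (mu : {measure set T -> \bar R}) (A D : set T) (f : T -> R) :
  measurable A -> measurable D ->
  A `<=` D -> (forall x, D x -> ~ A x -> f x = 0) ->
  mu.-integrable A (EFin \o f) -> mu.-integrable D (EFin \o f).
Proof.
move=> mA mD AD f0 /(integrable_mkcond _ mA) h; apply/(integrable_mkcond _ mD).
apply: eq_integrable h => // x _; rewrite !patchE.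
case: ifPn => [/set_mem Ax|/negP xA]; case: ifPn => [/set_mem Dx|/negP xD] //.
  by exfalso; apply: xD; rewrite inE; exact: AD.
by rewrite /= f0// => Ax; apply: xA; rewrite inE.
Qed.

Section DuBoisReymond.
Context {R : realType}.
Notation mu := (@lebesgue_measure R).
Implicit Types (f g h : R -> R).

Lemma measurable_dom : measurable (@dom R : set (measurableTypeR R)).
Proof. exact: measurable_itv. Qed.

#[local] Hint Extern 0 (measurable dom) => exact: measurable_dom : core.

Lemma dom_sub_seg : @dom R `<=` `[0, 1]%classic.
Proof. by apply: subset_itv; rewrite bnd_simp. Qed.

Lemma integrable_dom_seg f : mu.-integrable dom (EFin \o f) ->
  mu.-integrable `[0, 1] (EFin \o f).
Proof.
move=> /integrableP[/measurable_EFinP mf foo]; apply/integrableP; split.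
  by apply/measurable_EFinP; exact: measurable_fun_itv_cc mf.
rewrite integral_itv_bndoo//.
by do 2 apply: measurableT_comp => //.
Qed.

Lemma Rintegral_dom_seg f : mu.-integrable dom (EFin \o f) ->
  \int[mu]_(x in dom) f x = \int[mu]_(x in `[0, 1]) f x.
Proof.
move=> fi; have fi' := integrable_dom_seg fi.
rewrite /dom Rintegral_itv_obnd_cbnd//.
rewrite Rintegral_itv_bndo_bndc//.
by apply: integrableS fi' => //; apply: subset_itv; rewrite bnd_simp.
Qed.

Lemma primitive_continuous g : mu.-integrable `[0, 1] (EFin \o g) ->
  {within `[0, 1], continuous (primitive g)}.
Proof. by move=> gi; apply: parameterized_integral_continuous. Qed.

Lemma continuous_measurable_dom g : {within `[0, 1], continuous g} ->
  measurable_fun dom g.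
Proof.
move=> cg; have mg : measurable_fun (`[0, 1]%classic : set R) g.
  by apply: subspace_continuous_measurable_fun => //; exact: measurable_itv.
by apply: measurable_funS mg => //; exact: dom_sub_seg.
Qed.

Lemma continuous_bounded_seg g : {within `[0, 1], continuous g} ->
  exists2 M : R, 0 <= M & forall x, x \in `[0, 1] -> `|g x| <= M.
Proof.
move=> cg; have [M [_ HM]] := compact_bounded (continuous_compact cg (@segment_compact _ 0 1)).
exists (`|M| + 1); first by rewrite addr_ge0.
move=> x x01; apply: HM; first by rewrite (le_lt_trans (ler_norm _))// ltrDl.
by exists x.
Qed.

Lemma mu_dom : fine (mu dom) = 1.
Proof.
by rewrite /dom lebesgue_measure_itv/= lte_fin ltr01 -EFinB/= subr0.
Qed.

Lemma mu_dom_lty : (mu dom < +oo)%E.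
Proof. by rewrite /dom lebesgue_measure_itv/= lte_fin ltr01 -EFinB ltry. Qed.

Lemma bounded_integrable_dom g (M : R) : measurable_fun dom g ->
  (forall x, dom x -> `|g x| <= M) -> mu.-integrable dom (EFin \o g).
Proof.
move=> mg gM; apply: measurable_bounded_integrable => //.
- exact: mu_dom_lty.
- exists M; split; first exact: num_real.
  by move=> z Mz x xd; apply: (le_trans (gM x xd)); exact: ltW.
Qed.

Lemma integrable_mul_bounded f g (M : R) : mu.-integrable dom (EFin \o f) ->
  measurable_fun dom g -> (forall x, dom x -> `|g x| <= M) ->
  mu.-integrable dom (EFin \o (fun x => f x * g x)).
Proof.
move=> fi mg gM.
have := @integrableMl _ _ _ mu dom measurable_dom (EFin \o f) g fi mg.
apply; exists M; split; first exact: num_real.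
by move=> z Mz x xd; apply: (le_trans (gM x xd)); exact: ltW.
Qed.

(** The compact support of [h] inside (0,1) upgrades local integrability of [g] to integrability of
    the product on the whole interval. *)
Lemma locally_integrable_mul_integrable g h (a b : R) : 0 < a -> b < 1 ->
  locally_integrable dom g -> continuous h ->
  (forall x, ~~ (a <= x <= b) -> h x = 0) ->
  mu.-integrable dom (EFin \o (fun x => g x * h x)).
Proof.
move=> a0 b1 lg ch h0.
apply: (@integrable_subset_eq0 _ _ _ mu `[a, b]%classic).
- exact: measurable_itv.
- by [].
- exact: segment_sub_dom.
- by move=> x _ /= /negP xab; rewrite h0 ?mulr0//; move: xab; rewrite in_itv.
have gi := locally_integrable_integrable lg a0 b1.
have := @integrableMl _ _ _ mu `[a, b]%classic (measurable_itv _) (EFin \o g) h gi.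
apply; first by apply: measurable_funTS; exact: continuous_measurable_fun.
have ch' : {within `[a, b], continuous h} by exact: continuous_subspaceT.
have [M [Mr HM]] := compact_bounded (continuous_compact ch' (@segment_compact _ a b)).
by exists M; split => // z Mz x xab; apply: HM => //; exists x.
Qed.

Lemma test_function_continuous (psi : R -> R) : test_function psi -> continuous psi.
Proof.
move=> [dpsi _ _] x.
by apply: differentiable_continuous; apply/derivable1_diffP.
Qed.

Lemma weak_derivative_unique f g1 g2 :
  is_weak_derivative f g1 -> is_weak_derivative f g2 ->
  {ae mu, forall x, dom x -> g1 x = g2 x}.
Proof.
move=> [_ l1 H1] [_ l2 H2].
suff : {ae mu, forall x, dom x -> (g1 \- g2) x = 0}.
  by apply: ae_impl => x h xd; apply/eqP; rewrite -subr_eq0; apply/eqP/h.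
apply: locally_integrable_ae0; first exact: locally_integrableB.
move=> psi tpsi; have [_ _ [a [b [a0 b1 psi0]]]] := tpsi.
have cpsi := test_function_continuous tpsi.
under eq_Rintegral do rewrite /= mulrBl.
rewrite RintegralB//; last 2 first.
- exact: (locally_integrable_mul_integrable a0 b1).
- exact: (locally_integrable_mul_integrable a0 b1).
by apply/eqP; rewrite subr_eq0 -eqr_opp -H1// -H2.
Qed.

(** The primitive from minus infinity vanishes to the left of a by the support of [h], and to the
    right of b exactly because [h] has mean zero. *)
Lemma test_function_primitive (h : R -> R) (a b : R) : 0 < a -> b < 1 -> a <= b ->
  continuous h -> (forall x, ~~ (a <= x <= b) -> h x = 0) ->
  \int[mu]_(x in dom) h x = 0 ->
  exists2 psi, test_function psi & derive1 psi = h.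
Proof.
move=> a0 b1 ab ch h0 ih.
have ci : mu.-integrable `[a, b] (EFin \o h).
  by apply: continuous_compact_integrable; [exact: segment_compact|exact: continuous_subspaceT].
have ihT : mu.-integrable setT (EFin \o h).
  apply: (@integrable_subset_eq0 _ _ _ mu `[a, b]%classic setT h) => //.
  by move=> x _ /= /negP; rewrite in_itv/=; exact: h0.
have iy y : mu.-integrable `]-oo, y] (EFin \o h) by exact: integrableS ihT.
pose F x := \int[mu]_(t in `]-oo, x]) h t.
have dF x : derivable F x 1 /\ F^`()%classic x = h x.
  by apply: (@continuous_FTC1 _ h -oo%O x (x + 1)) => //; [rewrite ltrDl|exact: ltNyr|exact: ch].
have dFE : derive1 F = h by apply/funext => x; have [] := dF x.
exists F => //; split.
- by move=> x; have [] := dF x.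
- by rewrite dFE.
- exists a, b; split => // x; rewrite negb_and -!ltNge => /orP[xa|bx].
    rewrite /F (@eq_Rintegral _ _ _ _ _ (cst 0)) ?Rintegral_cst ?mul0r// => y.
    rewrite inE/= in_itv/= => yx; apply: h0.
    by rewrite negb_and -ltNge (le_lt_trans yx xa).
  rewrite -ih /F (@Rintegral_subset_eq0 _ _ _ mu `[a, b])//; last 2 first.
  + by move=> y; rewrite /= !in_itv/= => /andP[_ /le_lt_trans/(_ bx)/ltW].
  + by move=> y _ /= /negP; rewrite in_itv/=; exact: h0.
  apply/esym/Rintegral_subset_eq0; first exact: segment_sub_dom.
  by move=> y _ /= /negP; rewrite in_itv/=; exact: h0.
Qed.

Lemma primitive_derive1 (psi : R -> R) (x : R) : test_function psi ->
  0 <= x -> primitive (derive1 psi) x = psi x.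
Proof.
move=> tpsi; have [dpsi cpsi [a [b [a0 b1 psi0]]]] := tpsi.
have p0 : psi 0 = 0 by apply: psi0; rewrite negb_and -ltNge a0.
have cp := test_function_continuous tpsi.
rewrite le_eqVlt => /predU1P[<-|x0].
  by rewrite /primitive set_itv1 Rintegral_set1 p0.
rewrite /primitive /Rintegral (continuous_FTC2 (F := psi) x0); last 3 first.
- exact: continuous_subspaceT.
- split=> //.
  + by apply: cvg_at_right_filter; exact: cp.
  + by apply: cvg_at_left_filter; exact: cp.
- by [].
by rewrite p0 sube0.
Qed.

Lemma derive1_eq0_outside (psi : R -> R) (a b : R) :
  (forall x, ~~ (a <= x <= b) -> psi x = 0) ->
  forall x, ~~ (a <= x <= b) -> derive1 psi x = 0.
Proof.
move=> psi0 x xab; rewrite derive1E (@near_eq_derive _ _ _ _ (cst 0)).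
  exact: derive_cst.
move: xab; rewrite negb_and -!ltNge => /orP[xa|bx].
  near=> y; apply: psi0; rewrite negb_and -!ltNge.
  by apply/orP; left; near: y; exact: lt_nbhsl.
near=> y; apply: psi0; rewrite negb_and -!ltNge.
by apply/orP; right; near: y; exact: lt_nbhsr.
Unshelve. all: by end_near. Qed.

Lemma test_function_integrable g psi : locally_integrable dom g ->
  test_function psi -> mu.-integrable dom (EFin \o (fun x => g x * psi x)).
Proof.
move=> lg tpsi; have [_ _ [a [b [a0 b1 psi0]]]] := tpsi.
apply: (locally_integrable_mul_integrable a0 b1) => //.
exact: test_function_continuous.
Qed.

Lemma bounded_locally_integrable g (M : R) : measurable_fun dom g ->
  (forall x, dom x -> `|g x| <= M) -> locally_integrable dom g.
Proof.
move=> mg gM; apply: open_integrable_locally; first exact: interval_open.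
exact: bounded_integrable_dom gM.
Qed.

Lemma locally_integrable_cst (c : R) : locally_integrable dom (cst c).
Proof. exact: (@bounded_locally_integrable _ `|c|). Qed.

(** A test function may come with bounds a > b, in which case it is 0; widening both bounds to
    include 1/2 orders them and stays inside (0,1). *)
Lemma test_function_support (psi : R -> R) : test_function psi ->
  exists a b : R, [/\ 0 < a, b < 1, a <= b & forall x, ~~ (a <= x <= b) -> psi x = 0].
Proof.
move=> [_ _ [a [b [a0 b1 psi0]]]].
exists (Num.min a 2^-1), (Num.max b 2^-1).
have h0 : (0 : R) < 2^-1 by rewrite invr_gt0.
have h1 : (2^-1 : R) < 1 by rewrite invf_lt1// ltr1n.
split.
- by rewrite lt_min a0 h0.
- by rewrite gt_max b1 h1.
- by apply: (@le_trans _ _ 2^-1); rewrite ?ge_min ?le_max lexx orbT.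
- move=> x xab; apply: psi0; apply: contra xab => /andP[ax xb].
  by rewrite ge_min ax le_max xb.
Qed.

Lemma test_function_lincomb (k : R) psi chi : test_function psi ->
  test_function chi -> test_function (fun x => psi x - k * chi x).
Proof.
move=> tp tc; have [a [b [a0 b1 _ p0]]] := test_function_support tp.
have [a' [b' [a0' b1' _ c0]]] := test_function_support tc.
have [dp cp _] := tp; have [dc cc _] := tc.
have D (x : R) : is_derive x 1 (fun x => psi x - k * chi x) (derive1 psi x - k * derive1 chi x).
  have dpx : is_derive x (1 : R) psi (derive1 psi x) by rewrite derive1E; exact: derivableP.
  have dcx : is_derive x (1 : R) chi (derive1 chi x) by rewrite derive1E; exact: derivableP.
  exact: is_deriveB.
split.
- by move=> x; have [] := D x.
- rewrite (_ : derive1 _ = fun x => derive1 psi x - k * derive1 chi x).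
    by move=> x; apply: cvgB; [exact: cp|apply: cvgMr; exact: cc].
  by apply/funext => x; rewrite derive1E; have /@derive_val := D x.
- exists (Num.min a a'), (Num.max b b'); split.
  + by rewrite lt_min a0 a0'.
  + by rewrite gt_max b1 b1'.
  + move=> x xab; rewrite p0 ?c0 ?mulr0 ?subrr//.
      apply: contra xab => /andP[ax xb].
      by rewrite ge_min ax le_max xb !orbT.
    apply: contra xab => /andP[ax xb].
    by rewrite ge_min ax le_max xb.
Qed.

(** Fix a test function [e] of nonzero mean. Any [chi] minus a multiple [m e] of the same mean is
    the derivative of a test function, so the integral of [D chi] is [m] times that of [D e], that
    is [c] times the integral of [chi]; the fundamental lemma applies to [D - c]. *)
Lemma orthogonal_derivatives_constant (D : R -> R) : locally_integrable dom D ->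
  (forall psi, test_function psi ->
     \int[mu]_(x in dom) (D x * derive1 psi x) = 0) ->
  exists c, {ae mu, forall x, dom x -> D x = c}.
Proof.
move=> lD D0.
(* If every test function had mean zero, the fundamental lemma would make the constant 1 vanish
   almost everywhere on (0,1), and the conclusion would hold with any constant. *)
have [[e te ie]|noe] := pselect (exists2 e : R -> R, test_function e &
    \int[mu]_(x in dom) e x != 0); last first.
  exists 0; have : {ae mu, forall x, dom x -> (cst 1 : R -> R) x = 0}.
    apply: locally_integrable_ae0; first exact: locally_integrable_cst.
    move=> psi tpsi; have [/eqP|] := eqVneq (\int[mu]_(x in dom) psi x) 0.
      by move=> /eqP <-; apply: eq_Rintegral => x _; rewrite mul1r.
    by move=> n0; exfalso; apply: noe; exists psi.
  by apply: ae_impl => x h xd; have /eqP := h xd; rewrite oner_eq0.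
pose J (f : R -> R) := \int[mu]_(x in dom) f x.
pose c := J (fun x => D x * e x) / J e; exists c.
have l1 : locally_integrable dom (cst 1 : R -> R) by exact: locally_integrable_cst.
have test_int psi : test_function psi -> mu.-integrable dom (EFin \o psi).
  move=> /(test_function_integrable l1); apply: eq_integrable => // x _.
  by rewrite /= mul1r.
suff : {ae mu, forall x, dom x -> (D \- cst c) x = 0}.
  by apply: ae_impl => x h xd; have /eqP := h xd; rewrite /= subr_eq0 => /eqP.
apply: locally_integrable_ae0.
  by apply: locally_integrableB => //; exact: locally_integrable_cst.
move=> chi tchi; pose m := J chi / J e.
have th := test_function_lincomb m tchi te.
have [a [b [a0 b1 ab h0]]] := test_function_support th.
(* [chi - m e] has mean zero, so that it is the derivative of a test function. *)
have ih : \int[mu]_(x in dom) (chi x - m * e x) = 0.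
  rewrite RintegralB ?RintegralZl//; [|exact: test_int..|].
    by rewrite -/(J chi) -/(J e) /m divfK// subrr.
  by apply: integrable_scale => //; exact: test_int.
have [psi tpsi dpsi] := test_function_primitive a0 b1 ab
  (test_function_continuous th) h0 ih.
have := D0 _ tpsi; rewrite dpsi.
have iDc := test_function_integrable lD tchi.
have iDe := test_function_integrable lD te.
under eq_Rintegral do rewrite mulrBr mulrCA.
rewrite RintegralB ?RintegralZl//; last exact: integrable_scale.
under [in X in _ -> X]eq_Rintegral do rewrite /= mulrBl.
move=> /eqP; rewrite subr_eq0 => /eqP E.
rewrite RintegralB//; last by apply: integrable_scale => //; exact: test_int.
rewrite RintegralZl//; last exact: test_int.
rewrite E -/(J e) -/(J chi) -/(J (fun x => D x * e x)) /c /m.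
by field.
Qed.

(** The difference [f - primitive g] is orthogonal to all derivatives of test functions, because
    [primitive g] also has weak derivative [g]. *)
Lemma du_bois_reymond f g : is_weak_derivative f g ->
  mu.-integrable dom (EFin \o g) ->
  exists c, {ae mu, forall x, dom x -> f x = c + primitive g x}.
Proof.
move=> [lf lg H] ig; have ig' := integrable_dom_seg ig.
have cG := primitive_continuous ig'.
have [M M0 HM] := continuous_bounded_seg cG.
have lG : locally_integrable dom (primitive g).
  apply: open_integrable_locally; first exact: interval_open.
  apply: (@bounded_integrable_dom _ M); first exact: continuous_measurable_dom.
  by move=> x /dom_sub_seg xd; apply: HM.
pose D := f \- primitive g.
have lD : locally_integrable dom D by exact: locally_integrableB.
have D0 psi : test_function psi -> \int[mu]_(x in dom) (D x * derive1 psi x) = 0.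
  move=> tpsi; have [dpsi cpsi [a [b [a0 b1 psi0]]]] := tpsi.
  have dpsi0 := derive1_eq0_outside psi0.
  have i1 := locally_integrable_mul_integrable a0 b1 lf cpsi dpsi0.
  have i2 := locally_integrable_mul_integrable a0 b1 lG cpsi dpsi0.
  under eq_Rintegral do rewrite /= mulrBl.
  rewrite RintegralB// H//.
  have id : mu.-integrable `[0, 1] (EFin \o derive1 psi).
    by apply: continuous_compact_integrable; [exact: segment_compact|exact: continuous_subspaceT].
  have igp := test_function_integrable lg tpsi.
  rewrite [X in _ - X](_ : _ = - \int[mu]_(x in dom) (g x * psi x)) ?subrr//.
  transitivity (\int[mu]_(x in `[0, 1]) (derive1 psi x * primitive g x)).
    rewrite Rintegral_dom_seg//.
    by apply: eq_Rintegral => x _; rewrite mulrC.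
  (* The primitive of [derive1 psi] is [psi], and [psi 1] = 0, so the weight left in front of [g] is
     [- psi]. *)
  rewrite Fubini_triangle// Rintegral_dom_seg// -mulN1r.
  rewrite -RintegralZl//; last exact: integrable_dom_seg.
  apply: eq_Rintegral => x; rewrite inE/= in_itv/= => /andP[x0 x1].
  rewrite !primitive_derive1// (psi0 1); first by ring.
  by rewrite negb_and -!ltNge b1 orbT.
have [c Hc] := orthogonal_derivatives_constant lD D0; exists c.
by apply: ae_impl Hc => x h xd; rewrite -(h xd) /D/= subrK.
Qed.

End DuBoisReymond.

(** * The spaces H^1, H^1_0 and H^2 *)

#[local] Hint Extern 0 (measurable dom) => exact: measurable_dom : core.

Section H1.
Context {R : realType}.
Notation mu := (@lebesgue_measure R).
Implicit Types (f g h : R -> R).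

(** Near an interior point where [f] is nonzero, a whole ball would lie in the exceptional null set.
    The endpoints follow from one-sided limits. *)
Lemma continuous_ae0 f : {within `[0, 1], continuous f} ->
  {ae mu, forall x, dom x -> f x = 0} -> forall x, x \in `[0, 1] -> f x = 0.
Proof.
move=> cf [N [mN N0 fN]].
have [cin c0 c1] := (continuous_within_itvP f ltr01).1 cf.
have inner x : x \in `]0, 1[ -> f x = 0.
  move=> x01; apply/eqP/negP => /negP fx0.
  have cx := cin x x01.
  have : \forall y \near x, f y != 0 /\ dom y.
    near=> y; split.
      near: y; apply: (cvgr_neq0 _ cx fx0).
    near: y; apply: open_nbhs_nbhs; split=> //; exact: interval_open.
  move=> /nbhs_ballP[e /= e0 He].
  have : (mu (ball x e) <= mu N)%E.
    apply: le_measure; rewrite ?inE//; first exact: measurable_ball.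
    move=> y /He[fy0 dy]; apply: fN => /= /(_ dy) E.
    by rewrite E eqxx in fy0.
  rewrite N0 lebesgue_measure_ball; last exact: ltW.
  by rewrite lee_fin leNgt pmulrn_rgt0// e0.
move=> x; rewrite in_itv/= => /andP[].
rewrite le_eqVlt => /predU1P[<- _|x0].
  have near0 : \forall y \near 0^'+, f y = 0.
    near=> y; apply: inner; rewrite in_itv/=; apply/andP; split; near: y.
      exact: nbhs_right_gt.
    exact: nbhs_right_lt.
  have c0' : f y @[y --> 0^'+] --> (0 : R) by exact: cvg_near_cst.
  exact: (cvg_unique (@Rhausdorff R) c0 c0').
rewrite le_eqVlt => /predU1P[->|x1]; last by apply: inner; rewrite in_itv/= x0.
have near1 : \forall y \near 1^'-, f y = 0.
  near=> y; apply: inner; rewrite in_itv/=; apply/andP; split; near: y.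
    exact: nbhs_left_gt.
  exact: nbhs_left_lt.
have c1' : f y @[y --> 1^'-] --> (0 : R) by exact: cvg_near_cst.
exact: (cvg_unique (@Rhausdorff R) c1 c1').
Unshelve. all: by end_near. Qed.

Lemma continuous_ae_eq f g : {within `[0, 1], continuous f} ->
  {within `[0, 1], continuous g} ->
  {ae mu, forall x, dom x -> f x = g x} -> forall x, x \in `[0, 1] -> f x = g x.
Proof.
move=> cf cg fg x x01; apply/eqP; rewrite -subr_eq0; apply/eqP.
apply: (@continuous_ae0 (f \- g)) => //; first exact: within_continuousB.
by apply: ae_impl fg => y fg /fg /= ->; rewrite subrr.
Qed.

Lemma truncn1 : Num.truncn (1 : R) = 1%N.
Proof. exact: (@natrK R 1). Qed.

Lemma truncn2 : Num.truncn (2 : R) = 2%N.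
Proof. exact: (@natrK R 2). Qed.

Lemma sobolev_sqnorm1 f : sobolev_sqnorm 1 f = (l2_sqnorm f + l2_sqnorm (wderiv f))%E.
Proof.
by rewrite /sobolev_sqnorm truncn1 eqxx adde0 big_ord_recl big_ord1.
Qed.

Lemma sobolev_sqnorm2 f : sobolev_sqnorm 2 f =
  (l2_sqnorm f + l2_sqnorm (wderiv f) + l2_sqnorm (wderiv (wderiv f)))%E.
Proof.
by rewrite /sobolev_sqnorm truncn2 eqxx adde0 big_ord_recl big_ord_recl big_ord1 addeA.
Qed.

Definition square_integrable g : Prop :=
  measurable_fun dom g /\ mu.-integrable dom (EFin \o (fun x => g x ^+ 2)).

Lemma l2_sqnorm_ge0 g : (0 <= l2_sqnorm g)%E.
Proof. by apply: integral_ge0 => x _; rewrite lee_fin sqr_ge0. Qed.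

Lemma measurable_sqr g : measurable_fun dom g ->
  measurable_fun dom (fun x => g x ^+ 2).
Proof.
by move=> mg; apply: (measurableT_comp (f := fun y : R => y ^+ 2)) => //.
Qed.

Lemma square_integrableP g : measurable_fun dom g ->
  (l2_sqnorm g < +oo)%E <-> square_integrable g.
Proof.
move=> mg; split=> [gfin|[_ /integrableP[_]]]; last first.
  rewrite /l2_sqnorm; under eq_integral do rewrite /= ger0_norm ?sqr_ge0//.
  by [].
split=> //; apply/integrableP; split.
  by apply/measurable_EFinP; exact: measurable_sqr.
by under eq_integral do rewrite /= ger0_norm ?sqr_ge0//.
Qed.

Lemma l2_sqnormE g : square_integrable g ->
  l2_sqnorm g = (\int[mu]_(x in dom) (g x ^+ 2))%:E.
Proof.
move=> [_ gi]; rewrite /Rintegral fineK//.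
by apply: (integrable_fin_num _ gi).
Qed.

Lemma square_integrable_integrable g : square_integrable g ->
  mu.-integrable dom (EFin \o g).
Proof.
move=> [mg gi].
have i1 : mu.-integrable dom (EFin \o (fun=> 1 : R)).
  by apply: (@bounded_integrable_dom _ _ 1) => // x _; rewrite normr1.
have := integrableD measurable_dom gi i1.
apply: le_integrable => //; first exact/measurable_EFinP.
move=> x _; rewrite /= lee_fin [leRHS]ger0_norm ?addr_ge0 ?sqr_ge0//.
by rewrite -real_normK ?num_real//; have := normr_ge0 (g x); nra.
Qed.

Lemma square_integrable_lincomb (a : R) f g : square_integrable f -> square_integrable g ->
  square_integrable (fun x => a * f x + g x).
Proof.
move=> [mf fi] [mg gi].
have m : measurable_fun dom (fun x => a * f x + g x).
  by apply: measurable_funD => //; apply: measurable_funM.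
split=> //.
have i1 := integrable_scale (2 * a ^+ 2) measurable_dom fi.
have i2 := integrable_scale 2 measurable_dom gi.
have := integrableD measurable_dom i1 i2.
apply: le_integrable => //; first by apply/measurable_EFinP; exact: measurable_sqr.
move=> x _; rewrite /= lee_fin !ger0_norm ?sqr_ge0//; last first.
  apply: addr_ge0; apply: mulr_ge0; rewrite ?sqr_ge0//.
  by apply: mulr_ge0; rewrite ?sqr_ge0.
by have := sqr_ge0 (a * f x - g x); nra.
Qed.

(** The interval has measure 1, so [m] is the mean of [|g|], and the integral of [(|g| - m)^2],
    which is nonnegative, is the integral of [g^2] minus [m^2]. *)
Lemma L1_le_L2 g : square_integrable g ->
  \int[mu]_(x in dom) `|g x| <= Num.sqrt (\int[mu]_(x in dom) (g x ^+ 2)).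
Proof.
move=> sg; have [mg gi] := sg; have gi1 := square_integrable_integrable sg.
have ni : mu.-integrable dom (EFin \o (fun x => `|g x|)) := integrable_norm gi1.
set m := \int[mu]_(x in dom) `|g x|.
have m0 : 0 <= m by apply: Rintegral_ge0.
rewrite -(ger0_norm m0) -sqrtr_sqr ler_wsqrtr//.
have : 0 <= \int[mu]_(x in dom) (`|g x| - m) ^+ 2.
  by apply: Rintegral_ge0 => x _; exact: sqr_ge0.
have i1 : mu.-integrable dom (EFin \o (fun=> m ^+ 2 : R)).
  by apply: (@bounded_integrable_dom _ _ `|m ^+ 2|).
have i2 := integrable_scale (2 * m) measurable_dom ni.
rewrite (@eq_Rintegral _ _ _ mu _ (fun x => (g x ^+ 2 + m ^+ 2) - 2 * m * `|g x|)); last first.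
  by move=> x _; rewrite sqrrB real_normK ?num_real// -mulr_natl; ring.
rewrite RintegralB//; last exact: (integrableD measurable_dom gi i1).
have Ec : \int[mu]_(x in dom) (m ^+ 2) = m ^+ 2.
  by rewrite Rintegral_cst// mu_dom mulr1.
have En : \int[mu]_(x in dom) (2 * m * `|g x|) = 2 * m * m.
  by rewrite RintegralZl.
by rewrite RintegralD// Ec En; lra.
Qed.
End H1.

Section H10.
Context {R : realType}.
Notation mu := (@lebesgue_measure R).
Implicit Types (f g h : R -> R) (u v : R -> R[i]).

Lemma is_weak_derivative_wderiv f g :
  is_weak_derivative f g -> is_weak_derivative f (wderiv f).
Proof. by move=> fg; exact: (xgetPex _ (ex_intro _ g fg)). Qed.

#[local] Opaque wderiv.

Lemma locally_integrable_scale (a : R) f :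
  locally_integrable dom f -> locally_integrable dom (fun x => a * f x).
Proof.
move=> [mf oD foo]; split => //; first exact: measurable_funM.
move=> K KD cK; have mK : measurable K by exact: compact_measurable.
have fK : mu.-integrable K (EFin \o f).
  apply/integrableP; split; last exact: foo.
  by apply/measurable_EFinP; apply: measurable_funS mf.
by have /integrableP[_] := integrable_scale a mK fK.
Qed.

Lemma is_weak_derivative_lincomb (a : R) f1 g1 f2 g2 :
  is_weak_derivative f1 g1 -> is_weak_derivative f2 g2 ->
  is_weak_derivative (fun x => a * f1 x + f2 x) (fun x => a * g1 x + g2 x).
Proof.
move=> [lf1 lg1 H1] [lf2 lg2 H2]; split.
- by apply: locally_integrableD => //; exact: locally_integrable_scale.
- by apply: locally_integrableD => //; exact: locally_integrable_scale.
- move=> psi tpsi; have [a' [b' [a0 b1 _ psi0]]] := test_function_support tpsi.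
  have [_ cpsi _] := tpsi; have dpsi0 := derive1_eq0_outside psi0.
  have i1 := locally_integrable_mul_integrable a0 b1 lf1 cpsi dpsi0.
  have i2 := locally_integrable_mul_integrable a0 b1 lf2 cpsi dpsi0.
  have j1 := test_function_integrable lg1 tpsi.
  have j2 := test_function_integrable lg2 tpsi.
  transitivity (\int[mu]_(x in dom) (a * (f1 x * derive1 psi x) + f2 x * derive1 psi x)).
    by apply: eq_Rintegral => x _; rewrite mulrDl mulrA.
  rewrite RintegralD//; last exact: integrable_scale.
  rewrite RintegralZl// H1// H2//.
  rewrite mulrN -opprD; congr (- _).
  transitivity (\int[mu]_(x in dom) (a * (g1 x * psi x) + g2 x * psi x)); last first.
    by apply: eq_Rintegral => x _; rewrite mulrDl mulrA.
  rewrite RintegralD//; last exact: integrable_scale.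
  by rewrite RintegralZl.
Qed.

(** The weak derivative is kept as an arbitrary witness [g]: [wderiv] of a linear combination agrees
    only almost everywhere with the combination of the [wderiv], whereas pairs combine exactly. *)
Definition h1_pair f g : Prop :=
  [/\ is_weak_derivative f g, square_integrable f & square_integrable g].

Lemma locally_integrable_measurable f : locally_integrable dom f -> measurable_fun dom f.
Proof. by case. Qed.

Lemma in_sobolev1P f : in_sobolev 1 f -> h1_pair f (wderiv f).
Proof.
move=> [mf]; rewrite truncn1 => /(_ 0 isT) /= wf.
rewrite sobolev_sqnorm1 => fin.
have [_ /locally_integrable_measurable mg _] := wf.
split=> //.
  apply/square_integrableP => //; apply: le_lt_trans fin.
  by rewrite leeDl// l2_sqnorm_ge0.
apply/square_integrableP => //; apply: le_lt_trans fin.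
by rewrite leeDr// l2_sqnorm_ge0.
Qed.

Lemma l2_sqnorm_ae_eq f g : measurable_fun dom f -> measurable_fun dom g ->
  {ae mu, forall x, dom x -> f x = g x} -> l2_sqnorm f = l2_sqnorm g.
Proof.
move=> mf mg fg; apply: ae_eq_integral => //.
- by apply/measurable_EFinP; exact: measurable_sqr.
- by apply/measurable_EFinP; exact: measurable_sqr.
- by apply: ae_impl fg => x h xd; rewrite h.
Qed.

Lemma h1_pair_sobolev f g : h1_pair f g -> in_sobolev 1 f /\
  sobolev_sqnorm 1 f = (\int[mu]_(x in dom) (f x ^+ 2) + \int[mu]_(x in dom) (g x ^+ 2))%:E.
Proof.
move=> [wf sf sg]; have wf' := is_weak_derivative_wderiv wf.
have E : sobolev_sqnorm 1 f =
    (\int[mu]_(x in dom) (f x ^+ 2) + \int[mu]_(x in dom) (g x ^+ 2))%:E.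
  rewrite sobolev_sqnorm1 EFinD -!l2_sqnormE//.
  congr (_ + _)%E; apply: l2_sqnorm_ae_eq.
  - by have [_ /locally_integrable_measurable] := wf'.
  - by have [_ /locally_integrable_measurable] := wf.
  - exact: weak_derivative_unique wf' wf.
split; last exact: E.
split.
- by have [] := sf.
- by move=> j; rewrite truncn1 ltnS leqn0 => /eqP ->; exact wf'.
- by rewrite E ltry.
Qed.

Lemma h1_pair_lincomb (a : R) f1 g1 f2 g2 : h1_pair f1 g1 -> h1_pair f2 g2 ->
  h1_pair (fun x => a * f1 x + f2 x) (fun x => a * g1 x + g2 x).
Proof.
move=> [w1 sf1 sg1] [w2 sf2 sg2]; split.
- exact: is_weak_derivative_lincomb.
- exact: square_integrable_lincomb.
- exact: square_integrable_lincomb.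
Qed.

Lemma in_H10_lincomb (a : R) f1 f2 : in_H10 f1 -> in_H10 f2 ->
  in_H10 (fun x => a * f1 x + f2 x).
Proof.
move=> [s1 c1 [f10 f11]] [s2 c2 [f20 f21]]; split.
- have := h1_pair_lincomb a (in_sobolev1P s1) (in_sobolev1P s2).
  by move=> /h1_pair_sobolev[].
- move=> x; apply: cvgD; last exact: c2.
  by apply: cvgMr; exact: c1.
- by rewrite f10 f20 f11 f21 !mulr0 addr0.
Qed.

Lemma H1normE f : in_sobolev 1 f -> H1norm f =
  Num.sqrt (\int[mu]_(x in dom) (f x ^+ 2) + \int[mu]_(x in dom) (wderiv f x ^+ 2)).
Proof.
by move=> /in_sobolev1P /h1_pair_sobolev[_]; rewrite /H1norm => ->.
Qed.

(** The du Bois-Reymond lemma gives this almost everywhere up to a constant; continuity of both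
    sides makes it hold everywhere, and the boundary value at 0 makes the constant 0. *)
Lemma in_H10_primitive f : in_H10 f ->
  forall x, x \in `[0, 1] -> f x = primitive (wderiv f) x.
Proof.
move=> [sf cf [f0 f1]]; have [wf _ sg] := in_sobolev1P sf.
have ig := square_integrable_integrable sg.
have [c Hc] := du_bois_reymond wf ig.
have cp := primitive_continuous (integrable_dom_seg ig).
have cc : {within `[0, 1], continuous (fun x => c + primitive (wderiv f) x)}.
  by move=> x; apply: cvgD; [exact: cvg_cst|exact: cp].
have E := continuous_ae_eq cf cc Hc.
have c0 : c = 0.
  have := E 0; rewrite f0 in_itv/= lexx ler01 => /(_ isT).
  by rewrite /primitive set_itv1 Rintegral_set1 addr0.
by move=> x /E ->; rewrite c0 add0r.
Qed.

(** The one-dimensional Sobolev embedding, with constant 1 on an interval of length 1: [|f x|] is at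
    most the L^1 norm of the weak derivative, hence at most its L^2 norm. It turns H^1_0 estimates
    into estimates uniform in x. *)
Lemma H10_sup_bound f : in_H10 f -> forall x, x \in `[0, 1] -> `|f x| <= H1norm f.
Proof.
move=> hf x x01; have [sf _ _] := hf; have [wf sf2 sg] := in_sobolev1P sf.
have ig := integrable_dom_seg (square_integrable_integrable sg).
have x1 : x <= 1 by move: x01; rewrite in_itv/= => /andP[].
have ix : mu.-integrable `[0, x] (EFin \o wderiv f).
  by apply: integrableS ig => //; apply: subset_itvl; rewrite bnd_simp.
rewrite (in_H10_primitive hf x01) /primitive.
apply: (le_trans (le_normr_Rintegral _ ix)) => //.
apply: (@le_trans _ _ (\int[mu]_(t in `[0, 1]) `|wderiv f t|)).
  rewrite -subr_ge0 Rintegral_itvB ?bnd_simp//; last 2 first.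
  - exact: integrable_norm ig.
  - by move: x01; rewrite in_itv/= => /andP[].
  by apply: Rintegral_ge0.
have -> : \int[mu]_(t in `[0, 1]) `|wderiv f t| = \int[mu]_(t in dom) `|wderiv f t|.
  by rewrite Rintegral_dom_seg//; exact: (integrable_norm (square_integrable_integrable sg)).
apply: (le_trans (L1_le_L2 sg)); rewrite H1normE// ler_wsqrtr// lerDr.
by apply: Rintegral_ge0 => t _; exact: sqr_ge0.
Qed.

End H10.

(** * Green's formula *)

Section Green.
Context {R : realType}.
Notation mu := (@lebesgue_measure R).
Implicit Types (f g h P Q : R -> R) (u v : R -> R[i]).

Lemma in_sobolev2P f : in_sobolev 2 f ->
  [/\ is_weak_derivative f (wderiv f),
      is_weak_derivative (wderiv f) (wderiv (wderiv f)),
      square_integrable (wderiv f) & square_integrable (wderiv (wderiv f))].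
Proof.
move=> [mf]; rewrite truncn2 => w fin.
have w0 : is_weak_derivative f (wderiv f) by exact: (w 0 isT).
have w1 : is_weak_derivative (wderiv f) (wderiv (wderiv f)) by exact: (w 1 isT).
move: fin; rewrite sobolev_sqnorm2 => fin.
have [_ /locally_integrable_measurable m1 _] := w0.
have [_ /locally_integrable_measurable m2 _] := w1.
split=> //.
  apply/square_integrableP => //; apply: le_lt_trans fin.
  apply: (@le_trans _ _ (l2_sqnorm f + l2_sqnorm (wderiv f))%E).
    by rewrite leeDr// l2_sqnorm_ge0.
  by rewrite leeDl// l2_sqnorm_ge0.
apply/square_integrableP => //; apply: le_lt_trans fin.
by rewrite leeDr// adde_ge0// l2_sqnorm_ge0.
Qed.

Lemma in_H10_bounded f : in_H10 f ->
  exists2 M : R, 0 <= M & forall x, dom x -> `|f x| <= M.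
Proof.
move=> [_ cf _]; have [M M0 HM] := continuous_bounded_seg cf.
by exists M => // x /dom_sub_seg; exact: HM.
Qed.

Lemma in_H10_measurable f : in_H10 f -> measurable_fun dom f.
Proof. by move=> [[]]. Qed.

Lemma integrable_mul_H10 f g : mu.-integrable dom (EFin \o f) -> in_H10 g ->
  mu.-integrable dom (EFin \o (fun x => f x * g x)).
Proof.
move=> fi hg; have [M M0 HM] := in_H10_bounded hg.
exact: (integrable_mul_bounded fi (in_H10_measurable hg) HM).
Qed.

(** Write [Q] as the primitive of its weak derivative and apply Fubini on the triangle. The weak
    derivative of [P] is [c] plus the primitive of the second one, and constants do not matter since
    the weak derivative of [Q] has integral [Q 1] = 0; no boundary value of the derivative of [P]
    appears. *)
Lemma green_formula P Q : in_sobolev 2 P -> in_H10 Q ->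
  \int[mu]_(x in dom) (wderiv (wderiv P) x * Q x) =
  - \int[mu]_(x in dom) (wderiv P x * wderiv Q x).
Proof.
move=> sP hQ; have [wP wP1 sP1 sP2] := in_sobolev2P sP.
have [sQ cQ [Q0 Q1]] := hQ; have [wQ sqQ sqQ1] := in_sobolev1P sQ.
have iP2 := square_integrable_integrable sP2.
have iQ1 := square_integrable_integrable sqQ1.
have jP2 := integrable_dom_seg iP2; have jQ1 := integrable_dom_seg iQ1.
have [c Hc] := du_bois_reymond wP1 iP2.
have EQ := in_H10_primitive hQ.
have pQ1 : primitive (wderiv Q) 1 = 0.
  by rewrite -EQ ?Q1// in_itv/= lexx ler01.
have cp := primitive_continuous jP2.
have [M M0 HM] := continuous_bounded_seg cp.
have mp := continuous_measurable_dom cp.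
have HM' x : dom x -> `|primitive (wderiv (wderiv P)) x| <= M.
  by move=> /dom_sub_seg; exact: HM.
have iG : mu.-integrable dom
    (EFin \o (fun x => primitive (wderiv (wderiv P)) x * wderiv Q x)).
  have := integrable_mul_bounded iQ1 mp HM'.
  by apply: eq_integrable => // x _; rewrite /= mulrC.
have iPQ := integrable_mul_H10 iP2 hQ.
rewrite Rintegral_dom_seg//.
transitivity (\int[mu]_(x in `[0, 1])
    (wderiv (wderiv P) x * primitive (wderiv Q) x)).
  by apply: eq_Rintegral => x; rewrite inE => /EQ ->.
rewrite Fubini_triangle//.
have D0 : \int[mu]_(x in dom) wderiv Q x = 0.
  by rewrite Rintegral_dom_seg//; exact: pQ1.
set K := primitive (wderiv (wderiv P)) 1.
have iK : mu.-integrable dom (EFin \o (fun x => K * wderiv Q x)).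
  exact: integrable_scale.
have iKG := integrableB measurable_dom iK iG.
transitivity (\int[mu]_(x in dom)
   (K * wderiv Q x - primitive (wderiv (wderiv P)) x * wderiv Q x)).
  rewrite Rintegral_dom_seg//.
  by apply: eq_Rintegral => x _; rewrite mulrBl.
rewrite RintegralB// RintegralZl// D0 mulr0 sub0r; congr (- _).
have iC : mu.-integrable dom (EFin \o (fun x => c * wderiv Q x)).
  exact: integrable_scale.
(* The constant [c] is inserted at no cost, to rebuild the weak derivative of [P]; the constant [K]
   has just been dropped for the same reason. *)
transitivity (\int[mu]_(x in dom)
   (c * wderiv Q x + primitive (wderiv (wderiv P)) x * wderiv Q x)).
  by rewrite RintegralD// RintegralZl// D0 mulr0 add0r.
congr fine; apply: ae_eq_integral => //.
- by have /integrableP[] := integrableD measurable_dom iC iG.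
- apply/measurable_EFinP; apply: measurable_funM.
    by have [] := sP1.
  by have [] := sqQ1.
- by apply: ae_impl Hc => x E xd; rewrite E// mulrDl.
Qed.

(** The integrand of Lagrange's identity; its integral measures the failure of symmetry of the
    Laplacian. *)
Definition bracket P Q : R -> R :=
  fun x => P x * wderiv (wderiv Q) x - Q x * wderiv (wderiv P) x.

Lemma integral_bracket P Q : in_H10 P -> in_sobolev 2 P -> in_H10 Q -> in_sobolev 2 Q ->
  \int[mu]_(x in dom) bracket P Q x = 0.
Proof.
move=> hP sP hQ sQ; have [_ _ _ /square_integrable_integrable iP] := in_sobolev2P sP.
have [_ _ _ /square_integrable_integrable iQ] := in_sobolev2P sQ.
transitivity (\int[mu]_(x in dom) (wderiv (wderiv Q) x * P x - wderiv (wderiv P) x * Q x)).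
  by apply: eq_Rintegral => x _; rewrite /bracket [P x * _]mulrC [Q x * _]mulrC.
rewrite RintegralB//; [|exact: integrable_mul_H10..].
rewrite (green_formula sQ hP) (green_formula sP hQ).
have E : \int[mu]_(x in dom) (wderiv Q x * wderiv P x) =
    \int[mu]_(x in dom) (wderiv P x * wderiv Q x).
  by apply: eq_Rintegral => x _; rewrite mulrC.
by rewrite E addrN.
Qed.

Lemma integrable_bracket P Q : in_H10 P -> in_sobolev 2 P -> in_H10 Q -> in_sobolev 2 Q ->
  mu.-integrable dom (EFin \o bracket P Q).
Proof.
move=> hP sP hQ sQ; have [_ _ _ /square_integrable_integrable iP] := in_sobolev2P sP.
have [_ _ _ /square_integrable_integrable iQ] := in_sobolev2P sQ.
have := integrableB measurable_dom (integrable_mul_H10 iQ hP) (integrable_mul_H10 iP hQ).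
by apply: eq_integrable => // x _; rewrite /bracket/= [P x * _]mulrC [Q x * _]mulrC.
Qed.

Lemma bracket_expand (p0 p1 p2 l0 l1 l2 e : R) :
  (p1 - p0) / e * ((l2 - l0) / e) - (p2 - p0) / e * ((l1 - l0) / e) =
  e^-1 ^+ 2 * ((p1 * l2 - p2 * l1) - (p1 * l0 - p0 * l1) - (p0 * l2 - p2 * l0)).
Proof. ring. Qed.

(** The differences are taken of the second weak derivatives, not inside [wderiv], so that bilinear
    expansion into three brackets is a pointwise identity in which the terms in [P0] alone
    cancel. *)
Definition bracket_quotient e P0 P1 P2 (x : R) : R :=
  (P1 x - P0 x) / e * ((wderiv (wderiv P2) x - wderiv (wderiv P0) x) / e) -
  (P2 x - P0 x) / e * ((wderiv (wderiv P1) x - wderiv (wderiv P0) x) / e).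

Lemma bracket_quotientP (e : R) P0 P1 P2 :
  in_H10 P0 -> in_sobolev 2 P0 -> in_H10 P1 -> in_sobolev 2 P1 ->
  in_H10 P2 -> in_sobolev 2 P2 ->
  mu.-integrable dom (EFin \o bracket_quotient e P0 P1 P2) /\
  \int[mu]_(x in dom) bracket_quotient e P0 P1 P2 x = 0.
Proof.
move=> h0 s0 h1 s1 h2 s2.
have E x : bracket_quotient e P0 P1 P2 x =
    e^-1 ^+ 2 * (bracket P1 P2 x - bracket P1 P0 x - bracket P0 P2 x).
  exact: bracket_expand.
have i12 := integrable_bracket h1 s1 h2 s2.
have i10 := integrable_bracket h1 s1 h0 s0.
have i02 := integrable_bracket h0 s0 h2 s2.
have iB := integrableB measurable_dom i12 i10.
have iBB := integrableB measurable_dom iB i02.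
rewrite (_ : bracket_quotient e P0 P1 P2 = fun x =>
  e^-1 ^+ 2 * (bracket P1 P2 x - bracket P1 P0 x - bracket P0 P2 x)); last first.
  exact/funext.
split; first exact: integrable_scale.
rewrite (RintegralZl _ measurable_dom iBB).
rewrite (RintegralB measurable_dom iB i02) (RintegralB measurable_dom i12 i10).
have B12 := integral_bracket h1 s1 h2 s2.
have B10 := integral_bracket h1 s1 h0 s0.
have B02 := integral_bracket h0 s0 h2 s2.
have comb (c x y z : R) : x = 0 -> y = 0 -> z = 0 -> c * (x - y - z) = 0.
  by move=> -> -> ->; rewrite !subr0 mulr0.
exact: comb B12 B10 B02.
Qed.

End Green.

(** * Differentials on the phase space *)

#[local] Opaque sobolev_sqnorm.

Section Differential.
Context {R : realType}.
Notation mu := (@lebesgue_measure R).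
Implicit Types (f g : R -> R) (u v h k : R -> R[i]).

Definition cscale (a : R) h : R -> R[i] := fun x => a%:C * h x.

Lemma rep_lincomb (a : R) h k :
  rep (fun x => a%:C * h x + k x) = (fun x => a * rep h x + rep k x).
Proof.
apply/funext => x; rewrite /rep; case: (h x) => hr hi; case: (k x) => kr ki /=.
by rewrite mul0r subr0.
Qed.

Lemma imp_lincomb (a : R) h k :
  imp (fun x => a%:C * h x + k x) = (fun x => a * imp h x + imp k x).
Proof.
apply/funext => x; rewrite /imp; case: (h x) => hr hi; case: (k x) => kr ki /=.
by rewrite mul0r addr0.
Qed.

Lemma in_H10C_lincomb (a : R) h k : in_H10C h -> in_H10C k ->
  in_H10C (fun x => a%:C * h x + k x).
Proof.
move=> [h1 h2] [k1 k2]; split.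
  by rewrite rep_lincomb; exact: in_H10_lincomb.
by rewrite imp_lincomb; exact: in_H10_lincomb.
Qed.

(** Puts a multiple into the form [a h + k] in which closure of the space and linearity of
    differentials are stated. *)
Lemma cscaleE (a : R) h : cscale a h = (fun x => (a - 1)%:C * h x + h x).
Proof.
apply/funext => x; rewrite /cscale rmorphB rmorph1 /= mulrBl mul1r subrK//.
Qed.

Lemma in_H10C_cscale (a : R) h : in_H10C h -> in_H10C (cscale a h).
Proof. by move=> hh; rewrite cscaleE; exact: in_H10C_lincomb. Qed.

Lemma in_H10_scale (a : R) f : in_H10 f -> in_H10 (fun x => a * f x).
Proof.
move=> hf; rewrite (_ : (fun x => _) = fun x => (a - 1) * f x + f x).
  exact: in_H10_lincomb.
by apply/funext => x; rewrite mulrBl mul1r subrK.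
Qed.

Lemma in_H10B f g : in_H10 f -> in_H10 g -> in_H10 (fun x => f x - g x).
Proof.
move=> hf hg; rewrite (_ : (fun x => _) = fun x => (-1) * g x + f x).
  exact: in_H10_lincomb.
by apply/funext => x; rewrite mulN1r addrC.
Qed.

Lemma sobolev_sqnorm1_scale (a : R) f : in_sobolev 1 f ->
  fine (sobolev_sqnorm 1 (fun x => a * f x)) = a ^+ 2 * fine (sobolev_sqnorm 1 f) /\
  sobolev_sqnorm 1 f \is a fin_num /\
  sobolev_sqnorm 1 (fun x => a * f x) \is a fin_num.
Proof.
move=> /in_sobolev1P hf.
have [wf [mf if2] [mg ig2]] := hf.
have := h1_pair_lincomb (a - 1) hf hf.
have E (g : R -> R) : (fun x => (a - 1) * g x + g x) = (fun x => a * g x).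
  by apply/funext => x; rewrite mulrBl mul1r subrK.
rewrite !E => /h1_pair_sobolev[_ ->].
have [_ ->] := h1_pair_sobolev hf; split => //=.
have S (g : R -> R) : mu.-integrable dom (EFin \o (fun x => g x ^+ 2)) ->
   \int[mu]_(x in dom) ((a * g x) ^+ 2) = a ^+ 2 * \int[mu]_(x in dom) (g x ^+ 2).
  move=> ig; rewrite -RintegralZl//.
  by apply: eq_Rintegral => x _; rewrite exprMn.
by rewrite (S _ if2) (S _ ig2) mulrDr.
Qed.

Lemma rep_cscale (a : R) h : rep (cscale a h) = (fun x => a * rep h x).
Proof.
by apply/funext => x; rewrite /rep /cscale; case: (h x) => hr hi /=; rewrite mul0r subr0.
Qed.

Lemma imp_cscale (a : R) h : imp (cscale a h) = (fun x => a * imp h x).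
Proof.
by apply/funext => x; rewrite /imp /cscale; case: (h x) => hr hi /=; rewrite mul0r addr0.
Qed.

Lemma sqrt_fine_scale (a : R) (x1 x2 y1 y2 : \bar R) :
  fine y1 = a ^+ 2 * fine x1 -> fine y2 = a ^+ 2 * fine x2 ->
  x1 \is a fin_num -> x2 \is a fin_num -> y1 \is a fin_num -> y2 \is a fin_num ->
  Num.sqrt (fine (y1 + y2)%E) = `|a| * Num.sqrt (fine (x1 + x2)%E).
Proof.
move=> E1 E2 f1 f2 f3 f4.
by rewrite fineD// E1 E2 -mulrDr -fineD// sqrtrM ?sqr_ge0// sqrtr_sqr.
Qed.

Lemma H1normC_cscale (a : R) h : in_H10C h -> H1normC (cscale a h) = `|a| * H1normC h.
Proof.
move=> [[sr _ _] [si _ _]]; rewrite /H1normC /sobolev_sqnormC rep_cscale imp_cscale.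
have [E1 [f1 f2]] := sobolev_sqnorm1_scale a sr.
have [E2 [f3 f4]] := sobolev_sqnorm1_scale a si.
exact: sqrt_fine_scale E1 E2 f1 f3 f2 f4.
Qed.

Lemma H1normC_ge0 h : 0 <= H1normC h.
Proof. exact: sqrtr_ge0. Qed.

Lemma is_differential_scale (G : (R -> R[i]) -> R -> R) v A (a : R) h x :
  is_differential G v A -> in_H10C h -> dom x -> A (cscale a h) x = a * A h x.
Proof.
by move=> [_ lin _ _] hh xd; rewrite cscaleE lin// mulrBl mul1r subrK.
Qed.

(** The Frechet remainder at [e h] is small compared with e in the H^1 norm, and it lies in H^1_0,
    so the sup bound applies to it; dividing by e gives convergence uniform in x. *)
Lemma differential_quotient (G : (R -> R[i]) -> R -> R) v A h (eta : R) :
  is_differential G v A -> in_H10C h -> 0 < eta ->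
  exists2 delta : R, 0 < delta & forall e, 0 < e < delta ->
    in_H10 (G v) -> in_H10 (G (fun y => v y + cscale e h y)) ->
    forall x, dom x ->
    `|(G (fun y => v y + cscale e h y) x - G v x) / e - A h x| <= eta.
Proof.
move=> dA hh eta0; have [hA lin _ approx] := dA.
have N0 := H1normC_ge0 h.
have N1 : 0 < 1 + H1normC h by rewrite ltr_wpDr.
(* Adding 1 to the norm of [h] keeps the quotients meaningful when that norm is 0; the factor
   [H1normC h / (1 + H1normC h)] is at most 1. *)
have [delta d0 Hd] := approx (eta / (1 + H1normC h)) (divr_gt0 eta0 N1).
exists (delta / (1 + H1normC h)); first exact: divr_gt0.
move=> e /andP[e0 ed] hv hw x xd.
have heh := in_H10C_cscale e hh.
have nE : H1normC (cscale e h) = e * H1normC h by rewrite H1normC_cscale// gtr0_norm.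
have small : H1normC (cscale e h) < delta.
  rewrite nE; move: ed; rewrite ltr_pdivlMr// => ed; apply: le_lt_trans ed.
  by rewrite ler_pM2l// lerDr.
have := Hd _ heh small.
set r := (fun x => _ - _ - _) => Hr.
have hr : in_H10 r by apply: in_H10B; [exact: in_H10B|exact: hA].
have rx := H10_sup_bound hr (dom_sub_seg xd).
have rE : r x = e * ((G (fun y => v y + cscale e h y) x - G v x) / e - A h x).
  rewrite /r (is_differential_scale e dA hh xd) mulrBr mulrCA divff ?mulr1//.
  by rewrite gt_eqF.
have {rx} := le_trans rx Hr.
rewrite rE normrM (gtr0_norm e0) nE mulrCA ler_pM2l// => /le_trans; apply.
move: (H1normC h) N0 N1 => N N0 N1.
by rewrite mulrAC ler_pdivrMr// ler_pM2l// lerDr.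
Qed.

End Differential.

(** * The nonlinearity *)

Section Scalar.
Context {R : realType}.
Implicit Types (a b e r s K B lambda sigma : R).

Lemma powRS (r alpha : R) : 0 < alpha -> 0 <= r -> r `^ (alpha + 1) = r * r `^ alpha.
Proof. by move=> a0 r0; rewrite -mulr_powRB1 ?addrK// addr_gt0. Qed.

Lemma powRS_lipschitz (alpha r s K : R) : 0 < alpha -> 0 <= s -> s <= r -> r <= K ->
  r `^ (alpha + 1) - s `^ (alpha + 1) <= (alpha + 1) * K `^ alpha * (r - s).
Proof.
move=> a0 s0 sr rK; have r0 := le_trans s0 sr; have K0 := le_trans r0 rK.
have mono c : 0 <= c -> c <= K -> c `^ alpha <= K `^ alpha.
  by move=> c0 cK; apply: ge0_ler_powR => //; rewrite ?nnegrE// ltW.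
move: sr; rewrite le_eqVlt => /predU1P[->|sr]; first by rewrite !subrr mulr0.
(* At s = 0 the factorization of the power as r times [r] to the [alpha] suffices; for s > 0 the
   mean value theorem applies on [[s, r]]. *)
move: s0 sr; rewrite le_eqVlt => /predU1P[<- {}r0|s0 sr].
  rewrite powR0 ?gt_eqF ?addr_gt0// !subr0 powRS ?(ltW r0)// mulrC.
  rewrite ler_wpM2r ?(ltW r0)// (le_trans (mono _ (ltW r0) rK))//.
  by rewrite ler_peMl ?powR_ge0// lerDr ltW.
have dp x : x \in `]s, r[ -> is_derive x 1 (fun y => y `^ (alpha + 1)) ((alpha + 1) * x `^ alpha).
  rewrite in_itv/= => /andP[sx _]; have x0 := lt_trans s0 sx.
  by have := is_derive1_powR (alpha + 1) x0; rewrite addrK.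
have cp : {within `[s, r], continuous (fun y => y `^ (alpha + 1))}.
  apply: derivable_within_continuous => x; rewrite in_itv/= => /andP[sx _].
  by apply: derivable_powR; rewrite in_itv/= andbT (lt_le_trans s0).
have [c] := MVT sr dp cp; rewrite in_itv/= => /andP[sc cr] ->.
rewrite ler_wpM2r ?subr_ge0 ?(ltW sr)// ler_wpM2l ?addr_ge0 ?(ltW a0)//.
by apply: mono; [rewrite ltW// (lt_trans s0)|rewrite (le_trans (ltW cr))].
Qed.

(* The weight [s] compensates the singularity at 0 of the derivative of
   [r `^ alpha] when [alpha < 1]. *)
Lemma powR_weighted_lipschitz (alpha r s K : R) : 0 < alpha ->
  0 <= r <= K -> 0 <= s <= K ->
  `|r `^ alpha - s `^ alpha| * s <= (alpha + 2) * K `^ alpha * `|r - s|.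
Proof.
move=> a0 /andP[r0 rK] /andP[s0 sK].
have mono c : 0 <= c -> c <= K -> c `^ alpha <= K `^ alpha.
  move=> c0 cK; apply: ge0_ler_powR => //; rewrite ?nnegrE//; first exact: ltW.
  exact: le_trans cK.
have L : `|r `^ (alpha + 1) - s `^ (alpha + 1)| <= (alpha + 1) * K `^ alpha * `|r - s|.
  have [sr|rs] := leP s r.
    rewrite [X in _ <= _ * X]ger0_norm ?subr_ge0// ger0_norm.
      exact: powRS_lipschitz.
    by rewrite subr_ge0 ge0_ler_powR ?nnegrE// addr_ge0// ltW.
  rewrite distrC [X in _ <= _ * X]distrC.
  rewrite [X in _ <= _ * X]ger0_norm ?subr_ge0 ?(ltW rs)// ger0_norm.
    by apply: powRS_lipschitz => //; exact: ltW.
  by rewrite subr_ge0 ge0_ler_powR ?nnegrE ?(ltW rs)// addr_ge0// ltW.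
(* The weight raises the exponent to [alpha + 1], where the power is Lipschitz with factor
   [alpha + 1]; the remaining term adds 1, whence [alpha + 2]. *)
have E : (r `^ alpha - s `^ alpha) * s =
    (r `^ (alpha + 1) - s `^ (alpha + 1)) - r `^ alpha * (r - s).
  by rewrite !powRS//; ring.
have -> : `|r `^ alpha - s `^ alpha| * s = `|(r `^ alpha - s `^ alpha) * s|.
  by rewrite normrM (ger0_norm s0).
rewrite E.
apply: (le_trans (ler_normB _ _)); rewrite normrM (ger0_norm (powR_ge0 _ _)).
have := mono _ r0 rK; have := normr_ge0 (r - s); have := powR_ge0 r alpha; nra.
Qed.

Lemma cvg_difference_quotient (g : R -> R) (r d s : R) (e_ s_ : nat -> R) :
  is_derive r 1 g d -> (forall j, e_ j != 0) -> e_ @ \oo --> (0 : R) -> s_ @ \oo --> s ->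
  (fun j => (g (r + e_ j * s_ j) - g r) / e_ j) @ \oo --> d * s.
Proof.
move=> [dg gd] e0 ecv scv.
(* The increments [e_ j * s_ j] may vanish. Extending the difference quotient by its limit [d] at 0
   makes the factorization valid for every j. *)
pose k h := if h == 0 then d else (g (r + h) - g r) / h.
have kc : k h @[h --> (0:R)] --> d.
  have : {for (0:R), continuous k}.
    apply/continuous_withinNx; rewrite /k eqxx.
    have : h^-1 *: (g (h *: 1 + r) - g r) @[h --> (0:R)^'] --> d.
      by rewrite -gd; exact: dg.
    apply: cvg_trans; apply: near_eq_cvg; near=> h.
    have h0 : h != 0 by near: h; exact: nbhs_dnbhs_neq.
    by rewrite (negbTE h0) /GRing.scale/= mulr1 [h + r]addrC mulrC.
  by rewrite /prop_for /continuous_at {2}/k eqxx.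
have E j : (g (r + e_ j * s_ j) - g r) / e_ j = k (e_ j * s_ j) * s_ j.
  rewrite /k mulf_eq0 (negbTE (e0 j)) /=; have [->|sj0] := eqVneq (s_ j) 0.
    by rewrite mulr0 addr0 subrr mul0r mulr0.
  by rewrite invfM mulrA -[RHS]mulrA mulVf// mulr1.
under eq_cvg do rewrite E.
apply: cvgM => //.
have es : e_ j * s_ j @[j --> \oo] --> (0 : R).
  by rewrite -(mul0r s); exact: cvgM.
exact: (cvg_comp _ _ es kc).
Unshelve. all: by end_near. Qed.

Lemma cvg_powR (alpha r : R) (r_ : nat -> R) : 0 < alpha ->
  (forall j, 0 <= r_ j) -> 0 <= r -> r_ @ \oo --> r ->
  (fun j => r_ j `^ alpha) @ \oo --> r `^ alpha.
Proof.
move=> a0 r_0; rewrite le_eqVlt => /predU1P[<-|r0] rcv.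
  rewrite powR0 ?gt_eqF//; apply/cvgr0Pnorm_le => eps eps0.
  have d0 : 0 < eps `^ alpha^-1 by exact: powR_gt0.
  move/cvgr0Pnorm_le : rcv => /(_ _ d0) H.
  near=> j; have : `|r_ j| <= eps `^ alpha^-1 by near: j.
  rewrite ger0_norm// ger0_norm ?powR_ge0// => h.
  have : r_ j `^ alpha <= (eps `^ alpha^-1) `^ alpha.
    by apply: ge0_ler_powR => //; rewrite ?nnegrE ?powR_ge0// ltW.
  by rewrite -powRrM mulVf ?gt_eqF// powRr1// ltW.
have dp : derivable (fun x => x `^ alpha) r 1.
  by apply: derivable_powR; rewrite in_itv/= andbT.
have cp : {for r, continuous (fun x => x `^ alpha)}.
  by apply: differentiable_continuous; apply/derivable1_diffP.
exact: (cvg_comp _ _ rcv cp).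
Unshelve. all: by end_near. Qed.

Definition potential lambda sigma (P Q : R) : R :=
  lambda * Num.sqrt (P ^+ 2 + Q ^+ 2) `^ (2 * sigma).

Lemma dist_sqrt_sqr (a b c d : R) :
  `|Num.sqrt (a ^+ 2 + b ^+ 2) - Num.sqrt (c ^+ 2 + d ^+ 2)| <= `|a - c| + `|b - d|.
Proof.
set x := Num.sqrt (a ^+ 2 + _); set y := Num.sqrt _.
have x2 : x ^+ 2 = a ^+ 2 + b ^+ 2 by rewrite sqr_sqrtr// addr_ge0 ?sqr_ge0.
have y2 : y ^+ 2 = c ^+ 2 + d ^+ 2 by rewrite sqr_sqrtr// addr_ge0 ?sqr_ge0.
have x0 : 0 <= x by exact: sqrtr_ge0.
have y0 : 0 <= y by exact: sqrtr_ge0.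
(* Cauchy-Schwarz in the plane: the gap between the squares is [(a d - b c)^2]. *)
have cs : a * c + b * d <= x * y.
  apply: (le_trans (ler_norm _)).
  rewrite -(ger0_norm (mulr_ge0 x0 y0)) -ler_sqr ?nnegrE// !real_normK ?num_real//.
  by rewrite exprMn x2 y2; have := sqr_ge0 (a * d - b * c); nra.
rewrite -[leRHS]ger0_norm ?addr_ge0// -ler_sqr ?nnegrE//.
rewrite [leLHS]real_normK ?num_real// [leRHS]real_normK ?num_real//.
have := real_normK (num_real (a - c)); have := real_normK (num_real (b - d)).
have := normr_ge0 (a - c); have := normr_ge0 (b - d).
move: `|a - c| `|b - d| => m n m0 n0 n2 m2; nra.
Qed.

(* With [F (P, Q) = potential P Q *: (P, Q)], this is
   <d_h z, d_k F> - <d_k z, d_h F> for the difference quotients of step [e]. *)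
Definition symmetry_defect lambda sigma (e P Q Ph Qh Pk Qk : R) : R :=
  let f := potential lambda sigma in
  (Ph - P) / e * ((f Pk Qk * Pk - f P Q * P) / e) +
  (Qh - Q) / e * ((f Pk Qk * Qk - f P Q * Q) / e) -
  (Pk - P) / e * ((f Ph Qh * Ph - f P Q * P) / e) -
  (Qk - Q) / e * ((f Ph Qh * Qh - f P Q * Q) / e).

(** Splits each quotient of [f z] by the discrete product rule. The first term tends to 0 by mere
    continuity of [f]; in the other two the quotient of [f] is paired with a scalar product with the
    base point z = (P, Q), which vanishes where [f] may be singular. *)
Lemma symmetry_defectE lambda sigma (e P Q Ph Qh Pk Qk : R) : e != 0 ->
  let f := potential lambda sigma in
  let a1 := (Ph - P) / e in let a2 := (Qh - Q) / e in
  let b1 := (Pk - P) / e in let b2 := (Qk - Q) / e in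
  symmetry_defect lambda sigma e P Q Ph Qh Pk Qk =
  (f Pk Qk - f Ph Qh) * (a1 * b1 + a2 * b2) +
  (f Pk Qk - f P Q) / e * (a1 * P + a2 * Q) -
  (f Ph Qh - f P Q) / e * (b1 * P + b2 * Q).
Proof.
move=> e0 f a1 a2 b1 b2; rewrite /symmetry_defect /a1 /a2 /b1 /b2 -/f.
by move: (f Pk Qk) (f Ph Qh) (f P Q) => fk fh f0; field.
Qed.

(** As a power of the polynomial P^2 + Q^2, the potential can be differentiated without passing
    through the square root. *)
Lemma potentialE lambda sigma (P Q : R) :
  potential lambda sigma P Q = lambda * (P ^+ 2 + Q ^+ 2) `^ sigma.
Proof.
have r0 : 0 <= P ^+ 2 + Q ^+ 2 by rewrite addr_ge0 ?sqr_ge0.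
by rewrite /potential -powR12_sqrt// -powRrM mulrA mulVf ?mul1r ?pnatr_eq0.
Qed.

Lemma cvg_potential lambda sigma (P Q : R) (P_ Q_ : nat -> R) : 0 < sigma ->
  P_ @ \oo --> P -> Q_ @ \oo --> Q ->
  (fun j => potential lambda sigma (P_ j) (Q_ j)) @ \oo --> potential lambda sigma P Q.
Proof.
move=> s0 Pcv Qcv; under eq_cvg do rewrite potentialE; rewrite potentialE.
apply: cvgMr; apply: cvg_powR => //.
- by move=> j; rewrite addr_ge0 ?sqr_ge0.
- by rewrite addr_ge0 ?sqr_ge0.
- under eq_cvg do rewrite !expr2; rewrite !expr2.
  by apply: cvgD; exact: cvgM.
Qed.

Lemma cvg_perturbation (P a : R) (e_ P_ : nat -> R) : (forall j, e_ j != 0) ->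
  e_ @ \oo --> (0 : R) -> (fun j => (P_ j - P) / e_ j) @ \oo --> a ->
  P_ @ \oo --> P.
Proof.
move=> e0 ecv acv; have E j : P_ j = P + e_ j * ((P_ j - P) / e_ j).
  by rewrite mulrC divfK// subrKC.
have H : P + e_ j * ((P_ j - P) / e_ j) @[j --> \oo] --> P + 0 * a.
  by apply: cvgD; [exact: cvg_cst|exact: cvgM].
by move: H; rewrite mul0r addr0; under eq_cvg do rewrite -E.
Qed.

Lemma cvg_potential_quotient lambda sigma (P Q a1 a2 : R) (e_ P_ Q_ : nat -> R) :
  0 < P ^+ 2 + Q ^+ 2 -> (forall j, e_ j != 0) -> e_ @ \oo --> (0 : R) ->
  (fun j => (P_ j - P) / e_ j) @ \oo --> a1 ->
  (fun j => (Q_ j - Q) / e_ j) @ \oo --> a2 ->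
  (fun j => (potential lambda sigma (P_ j) (Q_ j) - potential lambda sigma P Q) / e_ j)
    @ \oo --> 2 * lambda * sigma * (P ^+ 2 + Q ^+ 2) `^ (sigma - 1) * (a1 * P + a2 * Q).
Proof.
move=> r0 e0 ecv acv bcv.
have Pcv := cvg_perturbation e0 ecv acv; have Qcv := cvg_perturbation e0 ecv bcv.
(* The difference quotient of P^2 + Q^2, factored as a difference of squares, so that the chain rule
   applies to its increment [e_ j * s_ j]. *)
pose s_ j := (P_ j - P) / e_ j * (P_ j + P) + (Q_ j - Q) / e_ j * (Q_ j + Q).
have scv : s_ @ \oo --> a1 * (P + P) + a2 * (Q + Q).
  by apply: cvgD; apply: cvgM => //; apply: cvgD => //; exact: cvg_cst.
have := cvg_difference_quotient (is_derive1_powR sigma r0) e0 ecv scv.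
move=> /(cvgM (@cvg_cst _ lambda _ \oo _)) H.
rewrite (_ : 2 * lambda * sigma * _ * _ =
  lambda * (sigma * (P ^+ 2 + Q ^+ 2) `^ (sigma - 1) *
    (a1 * (P + P) + a2 * (Q + Q)))); last by ring.
apply: cvg_trans H; apply: near_eq_cvg; apply: nearW => j /=.
rewrite !potentialE -mulrBr mulrA; congr (_ * (_ `^ _ - _) / _).
by rewrite /s_; have := e0 j => ej; field.
Qed.

(** For z != 0 the gradient of the potential is parallel to z, so both weighted terms tend to 2
    lambda sigma |z|^(2 sigma - 2) <a, z> <b, z> and cancel. For z = 0 they are identically 0. *)
Lemma cvg_symmetry_defect lambda sigma (P Q a1 a2 b1 b2 : R)
    (e_ Ph_ Qh_ Pk_ Qk_ : nat -> R) : 0 < sigma ->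
  (forall j, e_ j != 0) -> e_ @ \oo --> (0 : R) ->
  (fun j => (Ph_ j - P) / e_ j) @ \oo --> a1 ->
  (fun j => (Qh_ j - Q) / e_ j) @ \oo --> a2 ->
  (fun j => (Pk_ j - P) / e_ j) @ \oo --> b1 ->
  (fun j => (Qk_ j - Q) / e_ j) @ \oo --> b2 ->
  (fun j => symmetry_defect lambda sigma (e_ j) P Q (Ph_ j) (Qh_ j) (Pk_ j) (Qk_ j))
    @ \oo --> (0 : R).
Proof.
move=> s0 e0 ecv a1cv a2cv b1cv b2cv; pose f := potential lambda sigma.
have Phcv := cvg_perturbation e0 ecv a1cv; have Qhcv := cvg_perturbation e0 ecv a2cv.
have Pkcv := cvg_perturbation e0 ecv b1cv; have Qkcv := cvg_perturbation e0 ecv b2cv.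
under eq_cvg do rewrite symmetry_defectE//.
have T1 : (f (Pk_ j) (Qk_ j) - f (Ph_ j) (Qh_ j)) *
    ((Ph_ j - P) / e_ j * ((Pk_ j - P) / e_ j) + (Qh_ j - Q) / e_ j * ((Qk_ j - Q) / e_ j))
    @[j --> \oo] --> (0 : R).
  rewrite (_ : 0 = (f P Q - f P Q) * (a1 * b1 + a2 * b2)); last by rewrite subrr mul0r.
  apply: cvgM; last by apply: cvgD; exact: cvgM.
  by apply: cvgB; exact: cvg_potential.
have aPcv : (Ph_ j - P) / e_ j * P + (Qh_ j - Q) / e_ j * Q @[j --> \oo] --> a1 * P + a2 * Q.
  by apply: cvgD; exact: cvgMl.
have bPcv : (Pk_ j - P) / e_ j * P + (Qk_ j - Q) / e_ j * Q @[j --> \oo] --> b1 * P + b2 * Q.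
  by apply: cvgD; exact: cvgMl.
have [r0|r0] := ltP 0 (P ^+ 2 + Q ^+ 2).
  have H1 := @cvg_potential_quotient lambda sigma _ _ _ _ _ _ _ r0 e0 ecv b1cv b2cv.
  have H2 := @cvg_potential_quotient lambda sigma _ _ _ _ _ _ _ r0 e0 ecv a1cv a2cv.
  have := cvgB (cvgD T1 (cvgM H1 aPcv)) (cvgM H2 bPcv).
  set l := (X in _ --> X) => H; have l0 : l = 0 by rewrite /l; ring.
  by rewrite l0 in H; exact: H.
have /andP[/eqP P0 /eqP Q0] : (P == 0) && (Q == 0).
  rewrite -(sqrf_eq0 P) -(sqrf_eq0 Q) -paddr_eq0 ?sqr_ge0//.
  by rewrite eq_le; apply/andP; split=> //; rewrite addr_ge0 ?sqr_ge0.
apply: cvg_trans T1; apply: near_eq_cvg; apply: nearW => j /=.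
by rewrite P0 Q0 !mulr0 !addr0 !mulr0 !subr0 ?addr0.
Qed.

Lemma sqrt_sqr_le (a b B : R) : `|a| <= B -> `|b| <= B -> Num.sqrt (a ^+ 2 + b ^+ 2) <= 2 * B.
Proof.
move=> aB bB; have := dist_sqrt_sqr a b 0 0.
rewrite !expr0n !addr0 sqrtr0 !subr0 ger0_norm ?sqrtr_ge0// => /le_trans; apply.
by rewrite mulr_natl mulr2n lerD.
Qed.

Lemma potential_bound lambda sigma (a b B : R) : 0 < sigma -> `|a| <= B -> `|b| <= B ->
  `|potential lambda sigma a b| <= `|lambda| * (2 * B) `^ (2 * sigma).
Proof.
move=> s0 aB bB; rewrite /potential normrM ler_wpM2l// ger0_norm ?powR_ge0//.
apply: ge0_ler_powR; rewrite ?nnegrE ?sqrtr_ge0//.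
- by rewrite mulr_ge0// ltW.
- by rewrite mulr_ge0// (le_trans _ aB).
- exact: sqrt_sqr_le.
Qed.

Lemma abs_le_sqrtl (a b : R) : `|a| <= Num.sqrt (a ^+ 2 + b ^+ 2).
Proof. by rewrite -sqrtr_sqr ler_wsqrtr// lerDl sqr_ge0. Qed.

Lemma abs_le_sqrtr (a b : R) : `|b| <= Num.sqrt (a ^+ 2 + b ^+ 2).
Proof. by rewrite addrC abs_le_sqrtl. Qed.

(** The scalar product is at most [2 B |z|], and this [|z|] is the weight that makes the power
    Lipschitz. The moduli are at most [2 B] and differ by at most [2 B e], so e cancels and the two
    factors [2 B] give [4 B^2]. *)
Lemma potential_quotient_bound lambda sigma (e P Q Pk Qk a1 a2 B : R) : 0 < sigma ->
  0 < e -> `|P| <= B -> `|Q| <= B -> `|Pk| <= B -> `|Qk| <= B ->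
  `|a1| <= B -> `|a2| <= B -> `|(Pk - P) / e| <= B -> `|(Qk - Q) / e| <= B ->
  `|(potential lambda sigma Pk Qk - potential lambda sigma P Q) / e * (a1 * P + a2 * Q)|
    <= `|lambda| * ((2 * sigma + 2) * (2 * B) `^ (2 * sigma)) * (4 * B ^+ 2).
Proof.
move=> s0 e0 hP hQ hPk hQk ha1 ha2 hb1 hb2; have B0 : 0 <= B by exact: le_trans hP.
set rk := Num.sqrt (Pk ^+ 2 + Qk ^+ 2); set r := Num.sqrt (P ^+ 2 + Q ^+ 2).
set K := 2 * B.
have r0 : 0 <= r by exact: sqrtr_ge0.
have rK : 0 <= r <= K by rewrite r0 sqrt_sqr_le.
have rkK : 0 <= rk <= K by rewrite sqrtr_ge0 sqrt_sqr_le.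
have al0 : 0 < 2 * sigma by rewrite mulr_gt0.
have L := powR_weighted_lipschitz al0 rkK rK.
have D : `|rk - r| <= e * (2 * B).
  apply: (le_trans (dist_sqrt_sqr _ _ _ _)).
  move: hb1 hb2; rewrite !normrM !normfV (gtr0_norm e0) !ler_pdivrMr// => h1 h2.
  by nra.
have S : `|a1 * P + a2 * Q| <= 2 * B * r.
  apply: (le_trans (ler_normD _ _)); rewrite !normrM.
  have := ler_pM (normr_ge0 a1) (normr_ge0 P) ha1 (abs_le_sqrtl P Q).
  have := ler_pM (normr_ge0 a2) (normr_ge0 Q) ha2 (abs_le_sqrtr P Q).
  by rewrite -/r; nra.
rewrite /potential -/rk -/r -mulrBr.
rewrite !normrM normfV (gtr0_norm e0).
set A := `|_ - _| in L *.
have A0 : 0 <= A by exact: normr_ge0.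
have C0 : 0 <= (2 * sigma + 2) * K `^ (2 * sigma).
  by rewrite mulr_ge0 ?powR_ge0// addr_ge0// ltW.
have l0 := normr_ge0 lambda.
rewrite -!mulrA ler_wpM2l// mulrA mulrAC ler_pdivrMr//.
apply: (@le_trans _ _ (2 * B * (A * r))).
  by rewrite mulrCA ler_wpM2l.
have {}L : A * r <= (2 * sigma + 2) * K `^ (2 * sigma) * (e * (2 * B)).
  by apply: (le_trans L); rewrite ler_wpM2l.
have B2 : 0 <= 2 * B by rewrite mulr_ge0.
apply: (le_trans (ler_wpM2l B2 L)).
by rewrite le_eqVlt; apply/orP; left; apply/eqP; ring.
Qed.

(** The first summand bounds the term with [f Pk Qk - f Ph Qh], the second the two weighted
    quotients. It does not depend on e, as dominated convergence requires. *)
Definition defect_bound lambda sigma B : R :=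
  `|lambda| * (2 * B) `^ (2 * sigma) * 2 * (2 * B ^+ 2) +
  2 * (`|lambda| * ((2 * sigma + 2) * (2 * B) `^ (2 * sigma)) * (4 * B ^+ 2)).

Lemma symmetry_defect_bound lambda sigma (e P Q Ph Qh Pk Qk B : R) : 0 < sigma ->
  0 < e -> `|P| <= B -> `|Q| <= B -> `|Pk| <= B -> `|Qk| <= B -> `|Ph| <= B -> `|Qh| <= B ->
  `|(Ph - P) / e| <= B -> `|(Qh - Q) / e| <= B ->
  `|(Pk - P) / e| <= B -> `|(Qk - Q) / e| <= B ->
  `|symmetry_defect lambda sigma e P Q Ph Qh Pk Qk| <= defect_bound lambda sigma B.
Proof.
move=> s0 e0 hP hQ hPk hQk hPh hQh ha1 ha2 hb1 hb2.
have B0 : 0 <= B by exact: le_trans hP.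
rewrite symmetry_defectE ?gt_eqF//.
have H1 := potential_quotient_bound lambda s0 e0 hP hQ hPk hQk ha1 ha2 hb1 hb2.
have H2 := potential_quotient_bound lambda s0 e0 hP hQ hPh hQh hb1 hb2 ha1 ha2.
apply: (le_trans (ler_normB _ _)); apply: (le_trans (lerD (ler_normD _ _) (lexx _))).
rewrite /defect_bound -addrA; apply: lerD; last by rewrite mulr_natl mulr2n lerD.
have K1 := potential_bound lambda s0 hPk hQk.
have K2 := potential_bound lambda s0 hPh hQh.
rewrite normrM; apply: ler_pM => //.
  apply: (le_trans (ler_normB _ _)); rewrite mulr_natr mulr2n.
  exact: lerD.
apply: (le_trans (ler_normD _ _)); rewrite !normrM.
have := ler_pM (normr_ge0 _) (normr_ge0 _) ha1 hb1.
have := ler_pM (normr_ge0 _) (normr_ge0 _) ha2 hb2.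
by rewrite !normrM => h1 h2; rewrite mulr_natl mulr2n expr2 lerD.
Qed.
End Scalar.

(** * One step of the scheme *)

Section Step.
Context {R : realType}.
Notation mu := (@lebesgue_measure R).
Implicit Types (x e tau theta lambda sigma B : R).

(* The real and imaginary parts of u^n (old) and of u^(n+1) (new). *)
Record step := Step { pold : R -> R; qold : R -> R; pnew : R -> R; qnew : R -> R }.
Implicit Types s t : step.

Definition midP s x := (pold s x + pnew s x) / 2.
Definition midQ s x := (qold s x + qnew s x) / 2.

Definition admissible s : Prop :=
  [/\ in_H10 (pold s), in_H10 (qold s), in_H10 (pnew s), in_H10 (qnew s) &
      in_sobolev 2 (midP s) /\ in_sobolev 2 (midQ s)].

(** Real and imaginary parts of the scheme; the factor i exchanges the time increments. The noise
    sits in [c1] and [c2], shared by all the steps compared, so it drops out of their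
    differences. *)
Definition solves tau theta lambda sigma (c1 c2 : R -> R) s : Prop :=
  {ae mu, forall x, dom x ->
    - ((qnew s x - qold s x) / tau) + wderiv (wderiv (midP s)) x
      + theta * `|x| ^+ 2 * midP s x
      + potential lambda sigma (midP s x) (midQ s x) * midP s x = c1 x /\
    (pnew s x - pold s x) / tau + wderiv (wderiv (midQ s)) x
      + theta * `|x| ^+ 2 * midQ s x
      + potential lambda sigma (midP s x) (midQ s x) * midQ s x = c2 x}.

Definition quotient e s t : step :=
  Step (fun x => (pold s x - pold t x) / e) (fun x => (qold s x - qold t x) / e)
       (fun x => (pnew s x - pnew t x) / e) (fun x => (qnew s x - qnew t x) / e).

Definition wedge0 s t x := pold s x * qold t x - pold t x * qold s x.
Definition wedge1 s t x := pnew s x * qnew t x - pnew t x * qnew s x.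
Definition wedge_increment s t x := wedge1 s t x - wedge0 s t x.

Definition defect lambda sigma e s0 sh sk x :=
  symmetry_defect lambda sigma e (midP s0 x) (midQ s0 x)
    (midP sh x) (midQ sh x) (midP sk x) (midQ sk x).

Definition step_bounded B s : Prop := forall x, dom x ->
  [/\ `|pold s x| <= B, `|qold s x| <= B, `|pnew s x| <= B & `|qnew s x| <= B].

Definition step_measurable s : Prop :=
  [/\ measurable_fun dom (pold s), measurable_fun dom (qold s),
      measurable_fun dom (pnew s) & measurable_fun dom (qnew s)].

(** The old and new values are reflections of each other about the midpoint, with the half increment
    read off from the equation. *)
Lemma solve_increments tau (V c1 c2 fv p0 p1 q0 q1 P Q LP LQ : R) : tau != 0 ->
  P = (p0 + p1) / 2 -> Q = (q0 + q1) / 2 ->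
  - ((q1 - q0) / tau) + LP + V * P + fv * P = c1 ->
  (p1 - p0) / tau + LQ + V * Q + fv * Q = c2 ->
  [/\ p0 = P + tau / 2 * (LQ + V * Q + fv * Q - c2),
      p1 = P - tau / 2 * (LQ + V * Q + fv * Q - c2),
      q0 = Q - tau / 2 * (LP + V * P + fv * P - c1) &
      q1 = Q + tau / 2 * (LP + V * P + fv * P - c1)].
Proof.
by move=> t0 -> -> <- <-; split; field.
Qed.

(** With new = z + delta and old = z - delta, the terms quadratic in z and those quadratic in delta
    are the same in both wedges and cancel. The cross terms occur twice, which turns [tau / 2] into
    [tau], and the real factor [V] cancels by antisymmetry. *)
Lemma wedge_increment_algebra tau (V c1 c2 e P Q LP LQ f
    Ph Qh LPh LQh fh Pk Qk LPk LQk fk : R) : e != 0 ->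
  let A P Q LQ f := P + tau / 2 * (LQ + V * Q + f * Q - c2) in
  let B P Q LQ f := P - tau / 2 * (LQ + V * Q + f * Q - c2) in
  let C P Q LP f := Q - tau / 2 * (LP + V * P + f * P - c1) in
  let D P Q LP f := Q + tau / 2 * (LP + V * P + f * P - c1) in
  ((B Ph Qh LQh fh - B P Q LQ f) / e * ((D Pk Qk LPk fk - D P Q LP f) / e) -
   (B Pk Qk LQk fk - B P Q LQ f) / e * ((D Ph Qh LPh fh - D P Q LP f) / e)) -
  ((A Ph Qh LQh fh - A P Q LQ f) / e * ((C Pk Qk LPk fk - C P Q LP f) / e) -
   (A Pk Qk LQk fk - A P Q LQ f) / e * ((C Ph Qh LPh fh - C P Q LP f) / e)) =
  tau * ((Ph - P) / e * ((fk * Pk - f * P) / e) +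
         (Qh - Q) / e * ((fk * Qk - f * Q) / e) -
         (Pk - P) / e * ((fh * Ph - f * P) / e) -
         (Qk - Q) / e * ((fh * Qh - f * Q) / e)) +
  tau * (((Ph - P) / e * ((LPk - LP) / e) - (Pk - P) / e * ((LPh - LP) / e)) +
         ((Qh - Q) / e * ((LQk - LQ) / e) - (Qk - Q) / e * ((LQh - LQ) / e))).
Proof. by move=> e0 A B C D; rewrite /A /B /C /D; field. Qed.

Lemma midP_bound B s x : step_bounded B s -> dom x -> `|midP s x| <= B.
Proof.
move=> bs xd; have [h0 _ h1 _] := bs x xd.
rewrite /midP normrM normfV (ger0_norm (ler0n _ 2)) ler_pdivrMr//.
by apply: (le_trans (ler_normD _ _)); rewrite mulr_natr mulr2n lerD.
Qed.

Lemma midQ_bound B s x : step_bounded B s -> dom x -> `|midQ s x| <= B.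
Proof.
move=> bs xd; have [_ h0 _ h1] := bs x xd.
rewrite /midQ normrM normfV (ger0_norm (ler0n _ 2)) ler_pdivrMr//.
by apply: (le_trans (ler_normD _ _)); rewrite mulr_natr mulr2n lerD.
Qed.

Lemma midP_quotient e s t x : midP (quotient e s t) x = (midP s x - midP t x) / e.
Proof. by rewrite /midP /=; ring. Qed.

Lemma midQ_quotient e s t x : midQ (quotient e s t) x = (midQ s x - midQ t x) / e.
Proof. by rewrite /midQ /=; ring. Qed.

Lemma defect_le_bound lambda sigma e s0 sh sk B x : 0 < sigma -> 0 < e ->
  step_bounded B s0 -> step_bounded B sh -> step_bounded B sk ->
  step_bounded B (quotient e sh s0) -> step_bounded B (quotient e sk s0) -> dom x ->
  `|defect lambda sigma e s0 sh sk x| <= defect_bound lambda sigma B.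
Proof.
move=> sg0 e0 b0 bh bk bqh bqk xd.
by apply: symmetry_defect_bound => //; rewrite -?midP_quotient -?midQ_quotient;
  first [exact: midP_bound|exact: midQ_bound].
Qed.

Lemma measurable_midP s : step_measurable s -> measurable_fun dom (midP s).
Proof.
by move=> [m0 _ m1 _]; apply: measurable_funM => //; exact: measurable_funD.
Qed.

Lemma measurable_midQ s : step_measurable s -> measurable_fun dom (midQ s).
Proof.
by move=> [_ m0 _ m1]; apply: measurable_funM => //; exact: measurable_funD.
Qed.

Lemma measurable_potential lambda sigma (P Q : R -> R) :
  measurable_fun dom P -> measurable_fun dom Q ->
  measurable_fun dom (fun x => potential lambda sigma (P x) (Q x)).
Proof.
move=> mP mQ; apply: measurable_funM => //.
apply: (measurableT_comp (f := fun y : R => y `^ (2 * sigma))).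
  exact: measurable_powR.
apply: (measurableT_comp (f := @Num.sqrt R)).
  by apply: continuous_measurable_fun; exact: sqrt_continuous.
by apply: measurable_funD; exact: measurable_sqr.
Qed.

Lemma measurable_defect lambda sigma e s0 sh sk :
  step_measurable s0 -> step_measurable sh -> step_measurable sk ->
  measurable_fun dom (defect lambda sigma e s0 sh sk).
Proof.
move=> m0 mh mk; rewrite /defect /symmetry_defect.
have [mP0 mPh mPk] := And3 (measurable_midP m0) (measurable_midP mh) (measurable_midP mk).
have [mQ0 mQh mQk] := And3 (measurable_midQ m0) (measurable_midQ mh) (measurable_midQ mk).
have mF (P Q Z : R -> R) : measurable_fun dom P -> measurable_fun dom Q ->
    measurable_fun dom Z ->
    measurable_fun dom (fun x => potential lambda sigma (P x) (Q x) * Z x).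
  by move=> mP mQ mZ; apply: measurable_funM => //; exact: measurable_potential.
have mq (F G : R -> R) : measurable_fun dom F -> measurable_fun dom G ->
    measurable_fun dom (fun x => (F x - G x) / e).
  by move=> mF' mG; apply: measurable_funM => //; exact: measurable_funB.
apply: measurable_funB; [apply: measurable_funB; [apply: measurable_funD|]|];
  by apply: measurable_funM; apply: mq => //; exact: mF.
Qed.

Lemma measurable_wedge_increment s t : step_measurable s -> step_measurable t ->
  measurable_fun dom (wedge_increment s t).
Proof.
move=> [m0 m1 m2 m3] [m4 m5 m6 m7].
by apply: measurable_funB; apply: measurable_funB; apply: measurable_funM.
Qed.

Lemma admissible_measurable s : admissible s -> step_measurable s.
Proof. by move=> [h0 h1 h2 h3 _]; split; exact: in_H10_measurable. Qed.

Lemma quotient_measurable e s t : step_measurable s -> step_measurable t ->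
  step_measurable (quotient e s t).
Proof.
move=> [m0 m1 m2 m3] [m4 m5 m6 m7].
by split; apply: measurable_funM => //; exact: measurable_funB.
Qed.

Lemma wedge_increment_bound B s t x : step_bounded B s -> step_bounded B t -> dom x ->
  `|wedge_increment s t x| <= 4 * B ^+ 2.
Proof.
move=> bs bt xd; have [a0 a1 a2 a3] := bs x xd; have [b0 b1 b2 b3] := bt x xd.
have M (y z : R) : `|y| <= B -> `|z| <= B -> `|y * z| <= B ^+ 2.
  by move=> yB zB; rewrite normrM expr2 ler_pM.
rewrite /wedge_increment /wedge0 /wedge1.
have := M _ _ a0 b1; have := M _ _ b0 a1; have := M _ _ a2 b3; have := M _ _ b2 a3.
rewrite !ler_norml => /andP[h1 h2] /andP[h3 h4] /andP[h5 h6] /andP[h7 h8].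
by apply/andP; split; lra.
Qed.

Lemma midP_H10 s : admissible s -> in_H10 (midP s).
Proof.
move=> [h0 h1 h2 h3 _]; rewrite (_ : midP s = fun x => 2^-1 * (1 * pold s x + pnew s x)).
  by apply: in_H10_scale; exact: in_H10_lincomb.
by apply/funext => x; rewrite /midP mul1r mulrC.
Qed.

Lemma midQ_H10 s : admissible s -> in_H10 (midQ s).
Proof.
move=> [h0 h1 h2 h3 _]; rewrite (_ : midQ s = fun x => 2^-1 * (1 * qold s x + qnew s x)).
  by apply: in_H10_scale; exact: in_H10_lincomb.
by apply/funext => x; rewrite /midQ mul1r mulrC.
Qed.

(** An exact identity at fixed e: outside the union of three null sets the increment is [tau] times
    the defect plus two Laplacian brackets, and the latter integrate to 0. *)
Lemma integral_wedge_increment tau theta lambda sigma c1 c2 e B s0 sh sk :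
  tau != 0 -> 0 < sigma -> 0 < e ->
  admissible s0 -> admissible sh -> admissible sk ->
  solves tau theta lambda sigma c1 c2 s0 ->
  solves tau theta lambda sigma c1 c2 sh ->
  solves tau theta lambda sigma c1 c2 sk ->
  step_bounded B s0 -> step_bounded B sh -> step_bounded B sk ->
  step_bounded B (quotient e sh s0) -> step_bounded B (quotient e sk s0) ->
  \int[mu]_(x in dom) wedge_increment (quotient e sh s0) (quotient e sk s0) x =
  tau * \int[mu]_(x in dom) defect lambda sigma e s0 sh sk x.
Proof.
move=> t0 sg0 e0 a0 ah ak E0 Eh Ek b0 bh bk bqh bqk.
have m0 := admissible_measurable a0; have mh := admissible_measurable ah.
have mk := admissible_measurable ak.
have [_ _ _ _ [sP0 sQ0]] := a0; have [_ _ _ _ [sPh sQh]] := ah.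
have [_ _ _ _ [sPk sQk]] := ak.
have [iSP SP0] := bracket_quotientP e (midP_H10 a0) sP0 (midP_H10 ah) sPh (midP_H10 ak) sPk.
have [iSQ SQ0] := bracket_quotientP e (midQ_H10 a0) sQ0 (midQ_H10 ah) sQh (midQ_H10 ak) sQk.
pose SP := bracket_quotient e (midP s0) (midP sh) (midP sk).
pose SQ := bracket_quotient e (midQ s0) (midQ sh) (midQ sk).
have mD := measurable_defect lambda sigma e m0 mh mk.
have iD : mu.-integrable dom (EFin \o defect lambda sigma e s0 sh sk).
  apply: (bounded_integrable_dom mD) => x xd.
  exact: (defect_le_bound lambda sg0 e0 b0 bh bk bqh bqk xd).
have iS := integrableD measurable_dom iSP iSQ.
have iDS := integrableD measurable_dom iD iS.
transitivity (\int[mu]_(x in dom) (tau * (defect lambda sigma e s0 sh sk x + (SP x + SQ x)))).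
  congr fine; apply: ae_eq_integral => //.
  - apply/measurable_EFinP; apply: measurable_wedge_increment.
      exact: quotient_measurable.
    exact: quotient_measurable.
  - by have /integrableP[] := integrable_scale tau measurable_dom iDS.
  - have ae_and (F1 F2 : R -> Prop) (y : R) : (dom y -> F1 y) -> (dom y -> F2 y) ->
        dom y -> F1 y /\ F2 y by move=> h1 h2 yd; split; [exact: h1|exact: h2].
    have := ae_impl2 (ae_and _ _) E0 (ae_impl2 (ae_and _ _) Eh Ek).
    apply: ae_impl => x H xd; have [[e01 e02] [[eh1 eh2] [ek1 ek2]]] := H xd.
    congr EFin.
    have [r1 r2 r3 r4] := solve_increments t0 (erefl (midP s0 x)) (erefl (midQ s0 x)) e01 e02.
    have [r5 r6 r7 r8] := solve_increments t0 (erefl (midP sh x)) (erefl (midQ sh x)) eh1 eh2.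
    have [r9 r10 r11 r12] := solve_increments t0 (erefl (midP sk x)) (erefl (midQ sk x)) ek1 ek2.
    rewrite /wedge_increment /wedge0 /wedge1 /quotient /=.
    rewrite r1 r2 r3 r4 r5 r6 r7 r8 r9 r10 r11 r12.
    rewrite wedge_increment_algebra ?gt_eqF// -mulrDr.
    by [].
rewrite (RintegralZl _ measurable_dom iDS) (RintegralD measurable_dom iD iS).
rewrite (RintegralD measurable_dom iSP iSQ).
have comb (k y z w : R) : z = 0 -> w = 0 -> k * (y + (z + w)) = k * y.
  by move=> -> ->; rewrite !addr0.
exact: comb SP0 SQ0.
Qed.

End Step.

(** * Passing to the limit in the difference quotients *)

Section Limit.
Context {R : realType}.
Notation mu := (@lebesgue_measure R).
Implicit Types (x e eta tau theta lambda sigma B : R) (s t : @step R).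

(** A right neighbourhood of 0 with an explicit threshold, so that a single sequence can satisfy
    several such properties at every index, as the domination hypothesis demands. *)
Definition for_small (P : R -> Prop) : Prop :=
  exists2 d : R, 0 < d & forall e, 0 < e < d -> P e.

Lemma for_smallI (P Q : R -> Prop) : for_small P -> for_small Q ->
  for_small (fun e => P e /\ Q e).
Proof.
move=> [d d0 Pd] [d' d0' Qd]; exists (Num.min d d'); first by rewrite lt_min d0 d0'.
by move=> e; rewrite lt_min => /and3P[e0 ed ed']; split; [apply: Pd|apply: Qd]; apply/andP.
Qed.

Lemma for_smallS (P Q : R -> Prop) : (forall e, P e -> Q e) -> for_small P -> for_small Q.
Proof. by move=> PQ [d d0 Pd]; exists d => // e ed; exact/PQ/Pd. Qed.

Lemma for_small_lt (c : R) : 0 < c -> for_small (fun e => 0 < e < c).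
Proof. by move=> c0; exists c. Qed.

Definition step_near eta s t : Prop := forall x, dom x ->
  [/\ `|pold s x - pold t x| <= eta, `|qold s x - qold t x| <= eta,
      `|pnew s x - pnew t x| <= eta & `|qnew s x - qnew t x| <= eta].

Definition step_H10 s : Prop :=
  [/\ in_H10 (pold s), in_H10 (qold s), in_H10 (pnew s) & in_H10 (qnew s)].

Lemma step_bounded_le B B' s : B <= B' -> step_bounded B s -> step_bounded B' s.
Proof.
by move=> BB bs x xd; have [h0 h1 h2 h3] := bs x xd; split; exact: le_trans BB.
Qed.

Lemma step_H10_bounded s : step_H10 s -> exists2 B : R, 0 <= B & step_bounded B s.
Proof.
move=> [/in_H10_bounded[a a0 ha] /in_H10_bounded[b b0 hb]
        /in_H10_bounded[c c0 hc] /in_H10_bounded[d d0 hd]].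
exists (a + b + c + d); first by rewrite !addr_ge0.
move=> x xd; split; [move: (ha x xd)|move: (hb x xd)|move: (hc x xd)|move: (hd x xd)];
  lra.
Qed.

Lemma step_near_bounded eta B s t : step_near eta s t -> step_bounded B t ->
  step_bounded (B + eta) s.
Proof.
move=> st bt x xd; have [h0 h1 h2 h3] := st x xd; have [b0 b1 b2 b3] := bt x xd.
have T (y z : R) : `|y - z| <= eta -> `|z| <= B -> `|y| <= B + eta.
  move=> yz zB; rewrite -(subrK z y); apply: (le_trans (ler_normD _ _)).
  by rewrite addrC lerD.
by split; [exact: T h0 b0|exact: T h1 b1|exact: T h2 b2|exact: T h3 b3].
Qed.

(** A perturbed value differs from the base value by e times a quotient, and e < 1. *)
Lemma quotient_bounded e B s t : 0 < e < 1 -> step_bounded B t ->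
  step_bounded B (quotient e s t) -> step_bounded (2 * B) s.
Proof.
move=> /andP[e0 e1] bt bq x xd.
have [h0 h1 h2 h3] := bq x xd; have [b0 b1 b2 b3] := bt x xd.
have T (y z : R) : `|(y - z) / e| <= B -> `|z| <= B -> `|y| <= 2 * B.
  rewrite normrM normfV (gtr0_norm e0) ler_pdivrMr// => yz zB.
  have B0 : 0 <= B by exact: le_trans zB.
  rewrite -(subrK z y); apply: (le_trans (ler_normD _ _)).
  have := ler_wpM2l B0 (ltW e1); lra.
by split; [exact: T h0 b0|exact: T h1 b1|exact: T h2 b2|exact: T h3 b3].
Qed.

Lemma integrable_wedge0 s t : step_H10 s -> step_H10 t ->
  mu.-integrable dom (EFin \o wedge0 s t).
Proof.
move=> hs ht; have [B B0 bs] := step_H10_bounded hs; have [C C0 bt] := step_H10_bounded ht.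
have [s0 s1 _ _] := hs; have [t0 t1 _ _] := ht.
have h (f g : R -> R) : in_H10 f -> in_H10 g -> mu.-integrable dom (EFin \o (fun x => f x * g x)).
  move=> hf hg; apply: integrable_mul_H10 => //.
  have [M M0 HM] := in_H10_bounded hf.
  exact: (bounded_integrable_dom (in_H10_measurable hf) HM).
exact: (integrableB measurable_dom (h _ _ s0 t1) (h _ _ t0 s1)).
Qed.

Lemma integrable_wedge1 s t : step_H10 s -> step_H10 t ->
  mu.-integrable dom (EFin \o wedge1 s t).
Proof.
move=> [s0 s1 s2 s3] [t0 t1 t2 t3].
exact: (@integrable_wedge0 (Step (pnew s) (qnew s) (pold s) (qold s))
  (Step (pnew t) (qnew t) (pold t) (qold t))).
Qed.

Section Sequence.
Variables (tau theta lambda sigma : R) (c1 c2 : R -> R).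
(** [s0] plays the step started at v, [Lh e] and [Lk e] those started at v + e h and v + e k, and
    [th], [tk] the differentials at v applied to h and k. *)
Variables (s0 th tk : @step R) (Lh Lk : R -> @step R).
Hypotheses (tau0 : tau != 0) (sigma0 : 0 < sigma).
Hypotheses (a0 : admissible s0) (E0 : solves tau theta lambda sigma c1 c2 s0).
Hypothesis (ah : for_small (fun e => admissible (Lh e) /\
  solves tau theta lambda sigma c1 c2 (Lh e))).
Hypothesis (ak : for_small (fun e => admissible (Lk e) /\
  solves tau theta lambda sigma c1 c2 (Lk e))).
Hypothesis (dh : forall eta, 0 < eta ->
  for_small (fun e => step_near eta (quotient e (Lh e) s0) th)).
Hypothesis (dk : forall eta, 0 < eta ->
  for_small (fun e => step_near eta (quotient e (Lk e) s0) tk)).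
Hypotheses (hth : step_H10 th) (htk : step_H10 tk).

(** Here [f] is any reading of a step at x that is 1-Lipschitz for [step_near]; the four components
    and the two midpoints are all of this kind. *)
Lemma quotient_cvg (L : R -> @step R) t (e_ : nat -> R) (f : @step R -> R -> R) x :
  (forall eta s' t', step_near eta s' t' -> `|f s' x - f t' x| <= eta) ->
  (forall eta, 0 < eta -> for_small (fun e => step_near eta (quotient e (L e) s0) t)) ->
  (forall j, 0 < e_ j) -> e_ @ \oo --> (0 : R) ->
  (fun j => f (quotient (e_ j) (L (e_ j)) s0) x) @ \oo --> f t x.
Proof.
move=> fn dL e0 ecv; apply/cvgrPdist_le => eps eps0.
have [d d0 Hd] := dL eps eps0.
move/cvgr0Pnorm_lt : ecv => /(_ d d0) H.
near=> j; rewrite distrC; apply: fn; apply: Hd; rewrite e0 /=.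
by rewrite -[ltLHS](gtr0_norm (e0 j)); near: j.
Unshelve. all: by end_near. Qed.

Lemma integral_wedge_increment_limit :
  \int[mu]_(x in dom) wedge_increment th tk x = 0.
Proof.
have [B1 B10 b0] : exists2 B : R, 0 <= B & step_bounded B s0.
  by apply: step_H10_bounded; case: a0.
have [B2 B20 bh] := step_H10_bounded hth; have [B3 B30 bk] := step_H10_bounded htk.
have [d d0 Hd] := for_smallI (for_smallI (for_smallI ah ak)
  (for_smallI (dh ltr01) (dk ltr01))) (for_small_lt (@ltr01 R)).
(* The shift by 2 keeps [e_ 0] strictly below [d]. *)
pose e_ (j : nat) := d / j.+2%:R.
have e0 j : 0 < e_ j by rewrite divr_gt0// ltr0n.
have ed j : 0 < e_ j < d.
  by rewrite e0/= ltr_pdivrMr ?ltr0n// ltr_pMr// ltr1n.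
have en0 j : e_ j != 0 by rewrite gt_eqF.
have ecv : e_ @ \oo --> (0 : R).
  rewrite -[X in _ --> X](mulr0 d); apply: cvgM; first exact: cvg_cst.
  have := @cvg_harmonic R; rewrite -(cvg_shiftS (@harmonic R)); exact.
(* The bracket bounds [s0] and the quotients, the 1 being the closeness of the quotients to the
   differentials; the factor 2 covers the perturbed steps, by [quotient_bounded]. *)
pose B := 2 * (B1 + B2 + B3 + 1).
have bb0 : step_bounded B s0 by apply: step_bounded_le b0; rewrite /B; lra.
have Q j : [/\ admissible (Lh (e_ j)), admissible (Lk (e_ j)),
     solves tau theta lambda sigma c1 c2 (Lh (e_ j)) &
     solves tau theta lambda sigma c1 c2 (Lk (e_ j))] /\
   [/\ step_bounded B (quotient (e_ j) (Lh (e_ j)) s0),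
     step_bounded B (quotient (e_ j) (Lk (e_ j)) s0),
     step_bounded B (Lh (e_ j)) & step_bounded B (Lk (e_ j))].
  have [[[[hA hS] [kA kS]] [nh nk]] e01] := Hd _ (ed j).
  split=> //.
  have q1 : step_bounded (B1 + B2 + B3 + 1) (quotient (e_ j) (Lh (e_ j)) s0).
    by apply: step_bounded_le (step_near_bounded nh bh); lra.
  have q2 : step_bounded (B1 + B2 + B3 + 1) (quotient (e_ j) (Lk (e_ j)) s0).
    by apply: step_bounded_le (step_near_bounded nk bk); lra.
  have b0' : step_bounded (B1 + B2 + B3 + 1) s0 by apply: step_bounded_le b0; lra.
  split.
  - by apply: step_bounded_le q1; rewrite /B; lra.
  - by apply: step_bounded_le q2; rewrite /B; lra.
  - exact: (quotient_bounded e01 b0' q1).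
  - exact: (quotient_bounded e01 b0' q2).
have m0 := admissible_measurable a0.
have cvgh f x := @quotient_cvg Lh th e_ f x ^~ dh.
have cvgk f x := @quotient_cvg Lk tk e_ f x ^~ dk.
have cstint (c : R) : mu.-integrable dom (EFin \o (fun=> c)).
  by apply: (@bounded_integrable_dom _ _ `|c|).
have W : (fun j => \int[mu]_(x in dom) wedge_increment (quotient (e_ j) (Lh (e_ j)) s0)
     (quotient (e_ j) (Lk (e_ j)) s0) x) @ \oo --> \int[mu]_(x in dom) wedge_increment th tk x.
  apply: (@Rintegral_dominated_cvg _ _ _ mu dom _ _ (fun=> 4 * B ^+ 2)) => //.
  - move=> j; have [[aj bj _ _] _] := Q j.
    by apply: measurable_wedge_increment; apply: quotient_measurable => //;
      exact: admissible_measurable.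
  - move=> x xd.
    have h0 := cvgh pold x (fun eta s' t' n => let: And4 a _ _ _ := n x xd in a) e0 ecv.
    have h1 := cvgh qold x (fun eta s' t' n => let: And4 _ a _ _ := n x xd in a) e0 ecv.
    have h2 := cvgh pnew x (fun eta s' t' n => let: And4 _ _ a _ := n x xd in a) e0 ecv.
    have h3 := cvgh qnew x (fun eta s' t' n => let: And4 _ _ _ a := n x xd in a) e0 ecv.
    have k0 := cvgk pold x (fun eta s' t' n => let: And4 a _ _ _ := n x xd in a) e0 ecv.
    have k1 := cvgk qold x (fun eta s' t' n => let: And4 _ a _ _ := n x xd in a) e0 ecv.
    have k2 := cvgk pnew x (fun eta s' t' n => let: And4 _ _ a _ := n x xd in a) e0 ecv.
    have k3 := cvgk qnew x (fun eta s' t' n => let: And4 _ _ _ a := n x xd in a) e0 ecv.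
    exact: (cvgB (cvgB (cvgM h2 k3) (cvgM k2 h3)) (cvgB (cvgM h0 k1) (cvgM k0 h1))).
  - move=> j x xd; have [_ [bj ck _ _]] := Q j; exact: wedge_increment_bound.
have D : (fun j => \int[mu]_(x in dom) defect lambda sigma (e_ j) s0 (Lh (e_ j)) (Lk (e_ j)) x)
     @ \oo --> \int[mu]_(x in dom) (0 : R).
  apply: (@Rintegral_dominated_cvg _ _ _ mu dom _ _ (fun=> defect_bound lambda sigma B)) => //.
  - move=> j; have [[aj bj _ _] _] := Q j.
    by apply: measurable_defect => //; exact: admissible_measurable.
  - move=> x xd.
    have nP eta s' t' (n : step_near eta s' t') : `|midP s' x - midP t' x| <= eta.
      have [n0 _ n1 _] := n x xd; rewrite /midP -mulrBl normrM normfV (ger0_norm (ler0n _ 2)).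
      rewrite ler_pdivrMr// mulr_natr mulr2n opprD addrACA.
      by apply: (le_trans (ler_normD _ _)); exact: lerD.
    have nQ eta s' t' (n : step_near eta s' t') : `|midQ s' x - midQ t' x| <= eta.
      have [_ n0 _ n1] := n x xd; rewrite /midQ -mulrBl normrM normfV (ger0_norm (ler0n _ 2)).
      rewrite ler_pdivrMr// mulr_natr mulr2n opprD addrACA.
      by apply: (le_trans (ler_normD _ _)); exact: lerD.
    have h0 := cvgh midP x nP e0 ecv. have h1 := cvgh midQ x nQ e0 ecv.
    have k0 := cvgk midP x nP e0 ecv. have k1 := cvgk midQ x nQ e0 ecv.
    move: h0 h1 k0 k1.
    under eq_cvg do rewrite midP_quotient; move=> h0.
    under eq_cvg do rewrite midQ_quotient; move=> h1.
    under eq_cvg do rewrite midP_quotient; move=> k0.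
    under eq_cvg do rewrite midQ_quotient; move=> k1.
    exact: cvg_symmetry_defect h0 h1 k0 k1.
  - move=> j x xd; have [_ [bj ck dj ej]] := Q j; exact: defect_le_bound.
have E j : \int[mu]_(x in dom) wedge_increment (quotient (e_ j) (Lh (e_ j)) s0)
     (quotient (e_ j) (Lk (e_ j)) s0) x =
    tau * \int[mu]_(x in dom) defect lambda sigma (e_ j) s0 (Lh (e_ j)) (Lk (e_ j)) x.
  have [[aj bj cj dj] [b1 b2 b3 b4]] := Q j.
  exact: (integral_wedge_increment tau0 sigma0 (e0 j) a0 aj bj E0 cj dj bb0 b3 b4 b1 b2).
rewrite Rintegral_cst// mul0r in D.
have D' : (fun j => tau * \int[mu]_(x in dom)
    defect lambda sigma (e_ j) s0 (Lh (e_ j)) (Lk (e_ j)) x) @ \oo --> (0 : R).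
  rewrite -(mulr0 tau); apply: cvgM; first exact: cvg_cst.
  exact: D.
rewrite -(funext E) in D'.
exact: (cvg_unique (@Rhausdorff R) W D').
Qed.

Lemma wedge_conservation :
  \int[mu]_(x in dom) wedge1 th tk x = \int[mu]_(x in dom) wedge0 th tk x.
Proof.
have i0 := integrable_wedge0 hth htk; have i1 := integrable_wedge1 hth htk.
have := integral_wedge_increment_limit.
by rewrite (RintegralB measurable_dom i1 i0) => /eqP; rewrite subr_eq0 => /eqP.
Qed.
End Sequence.

End Limit.

(** * Conclusion *)

Section Conclusion.
Context {R : realType}.
Notation mu := (@lebesgue_measure R).
Notation phase := (R -> R[i]).
Implicit Types (v w h k : phase).

Definition scheme_step (u : nat -> phase -> R -> R[i]) n w : @step R :=
  Step (Defs.p_part (u n) w) (Defs.q_part (u n) w)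
    (Defs.p_part (u n.+1) w) (Defs.q_part (u n.+1) w).

Lemma rep_midpoint u n w :
  rep (midpoint (fun n => u n w) n) = midP (scheme_step u n w).
Proof.
apply/funext => x; rewrite /rep /midpoint /midP /scheme_step /Defs.p_part /rep /=.
have -> : (2 : R[i])^-1 = (2^-1)%:C by rewrite fmorphV rmorph_nat.
by case: (u n w x) => a b; case: (u n.+1 w x) => c d /=; ring.
Qed.

Lemma imp_midpoint u n w :
  imp (midpoint (fun n => u n w) n) = midQ (scheme_step u n w).
Proof.
apply/funext => x; rewrite /imp /midpoint /midQ /scheme_step /Defs.q_part /imp /=.
have -> : (2 : R[i])^-1 = (2^-1)%:C by rewrite fmorphV rmorph_nat.
by case: (u n w x) => a b; case: (u n.+1 w x) => c d /=; ring.
Qed.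

Lemma scheme_parts (tau V f : R) (z0 z1 l m c : R[i]) :
  'i * ((z1 - z0) / tau%:C) + l + V%:C * m + f%:C * m = c ->
  - ((complex.Im z1 - complex.Im z0) / tau) + complex.Re l + V * complex.Re m
    + f * complex.Re m = complex.Re c /\
  (complex.Re z1 - complex.Re z0) / tau + complex.Im l + V * complex.Im m
    + f * complex.Im m = complex.Im c.
Proof.
have -> : (tau%:C)^-1 = (tau^-1)%:C by rewrite fmorphV.
case: z0 => a0 b0; case: z1 => a1 b1; case: l => l1 l2; case: m => m1 m2.
by move=> <- /=; split; ring.
Qed.

Lemma normcE (z : R[i]) :
  Normc.normc z = Num.sqrt (complex.Re z ^+ 2 + complex.Im z ^+ 2).
Proof. by case: z. Qed.

Lemma scheme_solves tau theta lambda sigma N (dW : nat -> R -> R[i]) u n w :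
  midpoint_scheme tau theta lambda sigma N dW (fun n => u n w) -> (n < N)%N ->
  admissible (scheme_step u n w) /\
  solves tau theta lambda sigma (rep (fun x => dW n x / tau%:C))
    (imp (fun x => dW n x / tau%:C)) (scheme_step u n w).
Proof.
move=> [hH10 hE] nN; have [s2 E] := hE n nN.
have [P0 Q0] := hH10 n (ltnW nN); have [P1 Q1] := hH10 n.+1 nN.
split.
  split; [exact: P0|exact: Q0|exact: P1|exact: Q1|].
  by move: s2; rewrite /in_sobolevC rep_midpoint imp_midpoint.
apply: ae_impl E => x E xd; have {E} := scheme_parts (E xd).
have mP : complex.Re (midpoint (fun n => u n w) n x) = midP (scheme_step u n w) x.
  exact: (congr1 (fun f => f x) (rep_midpoint u n w)).
have mQ : complex.Im (midpoint (fun n => u n w) n x) = midQ (scheme_step u n w) x.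
  exact: (congr1 (fun f => f x) (imp_midpoint u n w)).
rewrite normcE mP mQ /laplacian /= rep_midpoint imp_midpoint => -[e1 e2].
by split; [exact: e1|exact: e2].
Qed.

Lemma phase_open_small (X0 : set phase) v h : phase_open X0 -> X0 v -> in_H10C h ->
  for_small (fun e => X0 (fun y => v y + cscale e h y)).
Proof.
move=> [_ oX] Xv hh; have [d d0 Hd] := oX v Xv.
have N0 := H1normC_ge0 h; have N1 : 0 < 1 + H1normC h by rewrite ltr_wpDr.
exists (d / (1 + H1normC h)); first exact: divr_gt0.
move=> e /andP[e0 ed]; apply: Hd; first exact: in_H10C_cscale.
rewrite H1normC_cscale// gtr0_norm//.
move: (H1normC h) N0 N1 ed => M M0 M1; rewrite ltr_pdivlMr// => ed.
by apply: le_lt_trans ed; rewrite ler_pM2l// lerDr.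
Qed.

Lemma differentialP (G : phase -> R -> R) v : phase_differentiable G v ->
  is_differential G v (differential G v).
Proof. by move=> [A dA]; exact: (xgetPex _ (ex_intro _ A dA)). Qed.

Lemma symplectic_step tau theta lambda sigma N (dW : nat -> R -> R[i]) (X0 : set phase)
    (u : nat -> phase -> R -> R[i]) n v h k :
  tau != 0 -> 0 < sigma -> solution_map tau theta lambda sigma N dW X0 u ->
  (n < N)%N -> X0 v -> in_H10C h -> in_H10C k ->
  symplectic_form (u n.+1) v h k = symplectic_form (u n) v h k.
Proof.
move=> t0 s0 [oX _ sch dif] nN Xv hh hk.
have [/differentialP dp0 /differentialP dq0] := dif n (ltnW nN) v Xv.
have [/differentialP dp1 /differentialP dq1] := dif n.+1 nN v Xv.
pose tg h := Step (differential (Defs.p_part (u n)) v h) (differential (Defs.q_part (u n)) v h)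
  (differential (Defs.p_part (u n.+1)) v h) (differential (Defs.q_part (u n.+1)) v h).
pose L h e := scheme_step u n (fun y => v y + cscale e h y).
have ok w : X0 w -> admissible (scheme_step u n w) /\
    solves tau theta lambda sigma (rep (fun x => dW n x / tau%:C))
    (imp (fun x => dW n x / tau%:C)) (scheme_step u n w).
  by move=> Xw; apply: (scheme_solves (sch w Xw)).
have tgH h' : in_H10C h' -> step_H10 (tg h').
  by move=> hh'; split; [case: dp0|case: dq0|case: dp1|case: dq1] => H _ _ _; exact: H.
have okL h' : in_H10C h' -> for_small (fun e => admissible (L h' e) /\
    solves tau theta lambda sigma (rep (fun x => dW n x / tau%:C))
    (imp (fun x => dW n x / tau%:C)) (L h' e)).
  by move=> hh'; apply: for_smallS (phase_open_small oX Xv hh') => e; exact: ok.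
have difL h' : in_H10C h' -> forall eta, 0 < eta ->
    for_small (fun e => step_near eta (quotient e (L h' e) (scheme_step u n v)) (tg h')).
  move=> hh' eta eta0.
  have [[a0 a1 a2 a3 _] _] := ok v Xv.
  have [d0 d00 D0] := differential_quotient dp0 hh' eta0.
  have [d1 d10 D1] := differential_quotient dq0 hh' eta0.
  have [d2 d20 D2] := differential_quotient dp1 hh' eta0.
  have [d3 d30 D3] := differential_quotient dq1 hh' eta0.
  (* Admissibility of the perturbed step is included because the uniform estimate needs its values
     in H^1_0. *)
  have := for_smallI (okL h' hh') (for_smallI (for_smallI (for_small_lt d00) (for_small_lt d10))
    (for_smallI (for_small_lt d20) (for_small_lt d30))).
  apply: for_smallS => e [[[b0 b1 b2 b3 _] _] [[e0 e1] [e2 e3]]] x xd; split.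
  - exact: (D0 e e0 a0 b0 x xd).
  - exact: (D1 e e1 a1 b1 x xd).
  - exact: (D2 e e2 a2 b2 x xd).
  - exact: (D3 e e3 a3 b3 x xd).
have [a0 E0] := ok v Xv.
(* The integrands of the symplectic forms at n and n + 1 are [wedge0] and [wedge1] of [tg h] and
   [tg k] by conversion. *)
exact: (wedge_conservation t0 s0 a0 E0 (okL h hh) (okL k hk) (difL h hh) (difL k hk)
  (tgH h hh) (tgH k hk)).
Qed.
End Conclusion.

Theorem theorem3p2
  (R : realType) (d : measure_display) (Omega : measurableType d)
  (P : probability Omega R) (F : R -> set (set Omega))
  (U : completeNormedModType R) (ip : U -> U -> R) (e : nat -> U)
  (s : R) (phi : U -> R -> R[i])
  (beta : nat -> 'I_2 -> R -> Omega -> R) (W : R -> Omega -> R -> R[i])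
  (T theta lambda sigma : R) (N : nat)
  (X0 : Omega -> set (R -> R[i])) (u : Omega -> nat -> (R -> R[i]) -> R -> R[i])
  (tau := T / N%:R) (t := fun n : nat => n%:R * tau)
  (hF : normal_filtration P F)
  (hip : inner_product ip)
  (he : orthonormal_basis ip e)
  (hbeta : iid_brownian_family P F beta)
  (hs : 0 <= s)
  (hphi : hilbert_schmidt e s phi)
  (hW : wiener_process P e s phi beta W)
  (hT : 0 < T) (hlambda : lambda != 0) (hsigma : 0 < sigma < 2) (hN : (0 < N)%N)
  (hu : {ae P, forall w,
     solution_map tau theta lambda sigma N
       (fun n x => W (t n.+1) w x - W (t n) w x) (X0 w) (u w)}) :
  {ae P, forall w, forall n, (n < N)%N ->
     forall v, X0 w v -> forall h k, in_H10C h -> in_H10C k ->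
       symplectic_form (u w n.+1) v h k = symplectic_form (u w n) v h k}.
Proof.
have tau0 : tau != 0 by rewrite /tau mulf_neq0 ?invr_eq0 ?pnatr_eq0 -?lt0n ?gt_eqF.
have /andP[sigma0 _] := hsigma.
apply: filterS hu => w hw n nN v Xv h k hh hk.
exact: (symplectic_step tau0 sigma0 hw nN Xv hh hk).
Qed.
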